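(* Let $\phi,\psi:A\to\mathcal F$ be ring homomorphisms and $f\in\mathcal F$ an isogeny from $\phi$ to $\psi$. Then for all $a\in A$, $\alpha\in\ker f$, $\beta\in\ker f^\ast$, $\langle\phi_a(\alpha),\beta\rangle_f=\langle\alpha,\psi_a^\ast(\beta)\rangle_f$; and the map $[\;,\;]_f:\ker f\times\ker f^\ast\to\operatorname{Hom}_{\mathbb F_q}(A,\mathbb F_q)$, $[\alpha,\beta]_f(a)=\langle\phi_a(\alpha),\beta\rangle_f$, is a continuous pairing of $A$-modules (i.e. $[a\alpha,\beta]_f=[\alpha,a\beta]_f=a\cdot[\alpha,\beta]_f$) such that the induced maps $\ker f\to\operatorname{Hom}_A(\ker f^\ast,\operatorname{Hom}_{\mathbb F_q}(A,\mathbb F_q))$ and $\ker f^\ast\to\operatorname{Hom}_A(\ker f,\operatorname{Hom}_{\mathbb F_q}(A,\mathbb F_q))$ are isomorphisms of topological $A$-modules. Furthermore, if $\Psi:A\to\mathcal F$ is a third ring homomorphism and $h$ is an isogeny from $\Psi$ to $\phi$, then: for all $\alpha\in\ker(f\circ h)$ and $\beta\in\ker f^\ast\subseteq\ker(f\circ h)^\ast$, $[\alpha,\beta]_{f\circ h}=[h(\alpha),\beta]_f$; and for all $\alpha\in\ker h\subseteq\ker(f\circ h)$ and $\beta\in\ker(f\circ h)^\ast$, $[\alpha,\beta]_{f\circ h}=[\alpha,f^\ast(\beta)]_h$.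
   Context: Let $q$ be a power of a prime $p$, $X$ a nonsingular projective curve over $\mathbb F_q$, $\infty$ a closed point, and $A$ the ring of regular functions on $X\setminus\{\infty\}$, with the discrete topology. Let $C$ be an algebraically closed field containing $\mathbb F_q$, complete with respect to a non-archimedean absolute value. $\mathcal F$ is the set of formal sums $f=\sum_{n\in\mathbb Z}a_n\tau^n$ ($a_n\in C$) such that $f(z)=\sum_na_nz^{q^n}$ converges for all $z\in C$; it is a ring under termwise addition and composition $(\sum a_i\tau^i)\circ(\sum b_j\tau^j)=\sum_n(\sum_{i+j=n}a_ib_j^{q^i})\tau^n$ (composition of maps), with $c\in C$ identified with multiplication by $c$. $\ker f=\{z\in C:f(z)=0\}$ with the topology from $C$. The adjoint is $f^\ast=\sum_na_n^{1/q^n}\tau^{-n}$. For nonzero $f$ and $\alpha\in\ker f$, $g_\alpha\in\mathcal F$ is the unique element with $f\circ\alpha=g_\alpha\circ(1-\tau)$, and $\langle\alpha,\beta\rangle_f=g_\alpha^\ast(\beta)\in\mathbb F_q$ for $\beta\in\ker f^\ast$. For ring homomorphisms $\phi,\psi:A\to\mathcal F$ ($a\mapsto\phi_a$), a nonzero $f\in\mathcal F$ is an isogeny from $\phi$ to $\psi$ if $\psi_a\circ f=f\circ\phi_a$ for all $a\in A$; then $\ker f$ is an $A$-module via $a\alpha=\phi_a(\alpha)$ and $\ker f^\ast$ via $a\beta=\psi_a^\ast(\beta)$ (similarly for $h$, $\ker h$ and $\ker(f\circ h)$ are $A$-modules via $\Psi$, $\ker h^\ast$ via $\phi^\ast$,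 $\ker(f\circ h)^\ast$ via $\psi^\ast$). $\operatorname{Hom}_{\mathbb F_q}(A,\mathbb F_q)$ has the compact-open (pointwise) topology and $A$-module structure $(c\cdot\chi)(x)=\chi(cx)$; $\operatorname{Hom}_A$ denotes continuous $A$-linear maps with the compact-open topology.
   Formalization: The ring homomorphisms φ, ψ, Ψ are required to be F_q-algebra homomorphisms (φ_c = c for c in F_q); otherwise the pairing need not be F_q-linear, e.g. A = F_q[t], φ_t = 0, φ_c = c^p, f = 1 − τ with q ≠ p. *)

(* Defs.v *)
From HB Require Import structures.
From mathcomp Require Import all_boot all_order all_algebra.
From mathcomp Require Import -(notations) mpoly.
From mathcomp Require Import all_classical all_reals all_analysis.

Set Implicit Arguments.
Unset Strict Implicit.
Unset Printing Implicit Defensive.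

Import Order.TTheory GRing.Theory Num.Theory.
Local Open Scope classical_set_scope.
Local Open Scope ring_scope.

(** * Nonsingular projective curves over a field *)

(** An integral closed subscheme [X] of [P^n] over [k] is given by its function
    field [K] and by homogeneous coordinates [xi] of its generic point: the
    homogeneous prime ideal of [X] in [k[x_0, ..., x_n]] is generated by the
    forms vanishing at [xi]. *)
Section Projective.
Variables (k : fieldType) (n : nat) (K : fieldType) (j : {rmorphism k -> K}).
Variable xi : 'I_n.+1 -> K.
Local Notation S := (mpoly n.+1 k).

Definition form (d : nat) (G : S) : Prop := G \is ishomog1 d mdeg.

Definition gen_eval (G : S) : K := mmap j xi G.

(** The points of [Proj k[x_0, ..., x_n]]: homogeneous prime ideals that do not
    contain the irrelevant ideal. *)
Record proj_point (P : set S) : Prop := {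
  pp_0 : P 0;
  pp_D : forall F G, P F -> P G -> P (F + G);
  pp_M : forall F G, P G -> P (F * G);
  pp_homog : forall F d, P F -> P (pihomog mdeg d F);
  pp_1 : ~ P 1;
  pp_prime : forall F G, P (F * G) -> P F \/ P G;
  pp_relevant : exists i, ~ P (mpolyX k (mnm1 i)) }.

Definition point_of (P : set S) : Prop :=
  proj_point P /\ forall d G, form d G -> gen_eval G = 0 -> P G.

Definition closed_point_of (P : set S) : Prop :=
  point_of P /\ forall Q, point_of Q -> P `<=` Q -> Q = P.

(** The local ring of [X] at [P], inside [K]. *)
Definition local_ring (P : set S) : set K :=
  [set z | exists d G H,
    [/\ form d G, form d H, ~ P H & z = gen_eval G / gen_eval H]].

End Projective.

(** [O] is a discrete valuation ring with fraction field [K]. *)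
Definition is_dvr (K : fieldType) (O : set K) : Prop :=
  exists pi : K, [/\ O pi, pi != 0, ~ O pi^-1 &
    forall z : K, z != 0 -> exists (u : K) (m : int),
      [/\ O u, O u^-1 & z = u * pi ^ m]].

Definition transcendental_over (k K : fieldType) (j : {rmorphism k -> K})
    (t : K) : Prop :=
  forall p : {poly k}, p != 0 -> (map_poly j p).[t] != 0.

(** [z] is algebraic over the subfield [k(t)]. *)
Definition algebraic_over_adjoin (k K : fieldType) (j : {rmorphism k -> K})
    (t z : K) : Prop :=
  exists p : {poly {poly k}},
    let pt := map_poly (fun c : {poly k} => (map_poly j c).[t]) p in
    pt != 0 /\ root pt z.

Record curve (k : fieldType) := Curve {
  cdim : nat;
  cfield : fieldType;
  cscal : {rmorphism k -> cfield};
  cgen : 'I_cdim.+1 -> cfield;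
  cgen_neq0 : exists i, cgen i != 0;
  cfield_gen : forall z : cfield, exists d G H,
    [/\ form d G, form d H, gen_eval cscal cgen H != 0 &
        z = gen_eval cscal cgen G / gen_eval cscal cgen H];
  ctrdeg1 : exists2 t, transcendental_over cscal t &
    forall z, algebraic_over_adjoin cscal t z;
  cnonsing : forall P, closed_point_of cscal cgen P ->
    is_dvr (local_ring cscal cgen P) }.

Record closed_point (k : fieldType) (X : curve k) := ClosedPoint {
  cpt :> set (mpoly (cdim X).+1 k);
  cptP : closed_point_of (cscal X) (@cgen _ X) cpt }.

(** Regular functions on [X \ {oo}]: as [X] is integral, the sections over an
    open set form the intersection of the local rings at its points. *)
Definition regular (k : fieldType) (X : curve k) (oo : closed_point X) :
    set (cfield X) :=
  [set z | forall P, point_of (cscal X) (@cgen _ X) P -> P <> oo ->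
           local_ring (cscal X) (@cgen _ X) P z].

Section RegularRing.
Variables (k : fieldType) (X : curve k) (oo : closed_point X).

Definition regular_pred : {pred cfield X} := fun z => `[< regular oo z >].

Lemma regular_const (c : k) : cscal X c \in regular_pred.
Proof.
apply/asboolP => P [PP _] _; exists 0%N, (mpolyC _ c), 1; split.
- apply/dhomogP=> m; rewrite msuppC; case: eqP => // _.
  by rewrite inE => /eqP->; exact: mf0.
- exact: dhomog1.
- exact: pp_1 PP.
- by rewrite /gen_eval mmapC rmorph1 divr1.
Qed.

Lemma regular_subring : subring_closed regular_pred.
Proof.
split.
- by rewrite -(rmorph1 (cscal X)) regular_const.
- move=> x y /asboolP xP /asboolP yP; apply/asboolP => P PX Poo.
  have [d [G [H [hG hH nPH ->]]]] := xP P PX Poo.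
  have [e [G' [H' [hG' hH' nPH' ->]]]] := yP P PX Poo.
  have H0 : gen_eval (cscal X) (@cgen _ X) H != 0.
    by apply/eqP => H0; apply: nPH; exact: PX.2 hH H0.
  have H'0 : gen_eval (cscal X) (@cgen _ X) H' != 0.
    by apply/eqP => H0'; apply: nPH'; exact: PX.2 hH' H0'.
  exists (d + e)%N, (G * H' - G' * H), (H * H'); split.
  + by apply: rpredB; [|rewrite addnC]; apply: dhomogM.
  + exact: dhomogM.
  + by move/(pp_prime PX.1) => [].
  + have := addf_div (gen_eval (cscal X) (@cgen _ X) G)
      (- gen_eval (cscal X) (@cgen _ X) G') H0 H'0.
    by rewrite !mulNr => ->; rewrite /gen_eval rmorphB !rmorphM.
- move=> x y /asboolP xP /asboolP yP; apply/asboolP => P PX Poo.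
  have [d [G [H [hG hH nPH ->]]]] := xP P PX Poo.
  have [e [G' [H' [hG' hH' nPH' ->]]]] := yP P PX Poo.
  exists (d + e)%N, (G * G'), (H * H'); split.
  + exact: dhomogM.
  + exact: dhomogM.
  + by move/(pp_prime PX.1) => [].
  + by rewrite /gen_eval !rmorphM /= mulf_div.
Qed.

HB.instance Definition _ :=
  GRing.isSubringClosed.Build (cfield X) regular_pred regular_subring.

Record regring := RegRing {
  regval :> cfield X;
  regvalP : regval \in regular_pred }.

HB.instance Definition _ := [isSub for regval].
HB.instance Definition _ := [Choice of regring by <:].
HB.instance Definition _ := [SubChoice_isSubComNzRing of regring by <:].

Definition regconst (c : k) : regring := RegRing (regular_const c).

End RegularRing.

(** * Fields with a non-archimedean absolute value *)

Record nonarch_absval (R : realType) (C : fieldType) := NonarchAbsval {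
  absv :> C -> R;
  absv_ge0 : forall x, 0 <= absv x;
  absv_eq0 : forall x, absv x = 0 <-> x = 0;
  absvM : forall x y, absv (x * y) = absv x * absv y;
  absvD : forall x y, absv (x + y) <= Num.max (absv x) (absv y) }.

(** The field [C] with the topology defined by [v]. *)
Definition valued (R : realType) (C : closedFieldType)
  (v : nonarch_absval R C) : Type := C.

Section Valued.
Variables (R : realType) (C : closedFieldType) (v : nonarch_absval R C).

HB.instance Definition _ := GRing.ClosedField.on (valued v).
HB.instance Definition _ := isPointed.Build (valued v) 0.

Definition absv_ball (x : valued v) (e : R) (y : valued v) : Prop :=
  v (x - y) < e.

Lemma absvN (x : C) : v (- x) = v x.
Proof.
have v1 : v 1 = 1.
  have v1_neq0 : v 1 != 0 by apply/eqP => /absv_eq0/eqP; rewrite oner_eq0.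
  by apply: (mulfI v1_neq0); rewrite -absvM !mulr1.
have : v (-1) ^+ 2 = 1 by rewrite expr2 -absvM mulrNN mulr1.
move=> /eqP; rewrite sqrf_eq1 => /orP[/eqP vN1|/eqP vN1].
  by rewrite -mulN1r absvM vN1 mul1r.
by have := absv_ge0 v (-1); rewrite vN1 oppr_ge0 ler10.
Qed.

Lemma absv_ball_center x (e : R) : 0 < e -> absv_ball x e x.
Proof. by move=> e0; rewrite /absv_ball subrr (absv_eq0 v 0).2. Qed.

Lemma absv_ball_sym x y (e : R) : absv_ball x e y -> absv_ball y e x.
Proof. by rewrite /absv_ball -absvN opprB. Qed.

Lemma absv_ball_triangle x y z (e1 e2 : R) :
  absv_ball x e1 y -> absv_ball y e2 z -> absv_ball x (e1 + e2) z.
Proof.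
rewrite /absv_ball => xy yz.
have -> : x - z = (x - y) + (y - z) by rewrite addrA subrK.
apply: le_lt_trans (absvD v _ _) _; rewrite gt_max.
rewrite (lt_le_trans xy) ?(lt_le_trans yz) ?lerDl ?lerDr //.
  exact: le_trans (absv_ge0 v _) (ltW xy).
exact: le_trans (absv_ge0 v _) (ltW yz).
Qed.

HB.instance Definition _ :=
  hasNbhs.Build (valued v) (nbhs_ (entourage_ absv_ball)).
HB.instance Definition _ := Nbhs_isPseudoMetric.Build R (valued v)
  erefl absv_ball_center absv_ball_sym absv_ball_triangle erefl.

Definition absv_complete : Prop :=
  forall F : set_system (valued v), ProperFilter F -> cauchy F -> cvg F.

End Valued.

(** * The series [sum_(n in Z) a_n tau^n] and their pairings *)

Section Series.
Variables (R : realType) (Fq : finFieldType) (C : closedFieldType).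
Variable v : nonarch_absval R C.
Local Notation Cv := (valued v).
Variable iota : {rmorphism Fq -> C}.
Local Notation q := #|Fq|.

(** A sum over [Z] converges when both halves do. *)
Definition zcvg (u : int -> Cv) : Prop :=
  cvgn (series (fun n : nat => u n%:Z)) /\
  cvgn (series (fun n : nat => u (- n.+1%:Z))).

Definition zsum (u : int -> Cv) : Cv :=
  limn (series (fun n : nat => u n%:Z)) +
  limn (series (fun n : nat => u (- n.+1%:Z))).

(** [qpow n z] is [z ^ (q ^ n)]; for [n < 0] it is the (unique, as [C] is
    perfect) [q ^ (- n)]-th root of [z]. *)
Definition qpow (n : int) (z : Cv) : Cv :=
  match n with
  | Posz m => z ^+ (q ^ m)
  | Negz m => xget 0 [set y : Cv | y ^+ (q ^ m.+1) = z]
  end.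

(** [sum_n a_n tau^n] is represented by [n |-> a_n]. *)
Definition fseries := int -> Cv.

Definition everywhere_cvg (f : fseries) : Prop :=
  forall z, zcvg (fun n => f n * qpow n z).

Definition feval (f : fseries) (z : Cv) : Cv := zsum (fun n => f n * qpow n z).

Definition fker (f : fseries) : set Cv := [set z | feval f z = 0].

Definition fcomp (f g : fseries) : fseries :=
  fun n => zsum (fun i => f i * qpow i (g (n - i))).

Definition fconst (c : Cv) : fseries := fun n => if n == 0 then c else 0.

Definition ftau : fseries := fun n => if n == 1 then 1 else 0.

(** The coefficient of [tau^m] in [f^* = sum_n a_n^(1/q^n) tau^(-n)] is
    obtained for [n = - m]. *)
Definition fadj (f : fseries) : fseries := fun m => qpow m (f (- m)).

Definition fdiv (f : fseries) (alpha : Cv) : fseries :=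
  xget (fconst 0) [set g | everywhere_cvg g /\
    fcomp f (fconst alpha) = fcomp g (fun n => fconst 1 n - ftau n)].

(** [<alpha, beta>_f], as the element of [Fq] whose image in [C] is
    [g_alpha^*(beta)]. *)
Definition pairing (f : fseries) (alpha beta : Cv) : Fq :=
  xget 0 [set c | iota c = feval (fadj (fdiv f alpha)) beta].

(** ** A-modules *)

Variables (A : comNzRingType) (constA : Fq -> A).

(** Ring homomorphisms from [A] to the ring of everywhere convergent series,
    compatible with [Fq] (otherwise [bracket] below is not [Fq]-linear). *)
Record series_hom (phi : A -> fseries) : Prop := {
  sh_cvg : forall a, everywhere_cvg (phi a);
  sh_add : forall a b, phi (a + b) = (fun n => phi a n + phi b n);
  sh_mul : forall a b, phi (a * b) = fcomp (phi a) (phi b);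
  sh_one : phi 1 = fconst 1;
  sh_const : forall c, phi (constA c) = fconst (iota c) }.

Definition isogeny (phi psi : A -> fseries) (f : fseries) : Prop :=
  [/\ everywhere_cvg f, f <> fconst 0 &
      forall a, fcomp (psi a) f = fcomp f (phi a)].

Definition bracket (f : fseries) (phi : A -> fseries) (alpha beta : Cv) :
    A -> Fq :=
  fun a => pairing f (feval (phi a) alpha) beta.

(** The [A]-module structure on functions [A -> Fq]. *)
Definition dscale (c : A) (chi : A -> Fq) : A -> Fq := fun x => chi (c * x).

(** [Hom_Fq(A, Fq)], a subspace of [A -> Fq] with the compact-open topology. *)
Definition dual_set :
    set {compact-open, discrete_topology A -> discrete_topology Fq} :=
  [set chi : A -> Fq | (forall x y, chi (x + y) = chi x + chi y) /\
    (forall c x, chi (constA c * x) = c * chi x)].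

Definition dual : Type := set_type dual_set.
HB.instance Definition _ := Topological.on dual.

Definition dual_fun (chi : dual) : A -> Fq := \val chi.
Coercion dual_fun : dual >-> Funclass.

(** [M] is an [A]-module for the addition of [C] and the action [act]. *)
Record Amodule (M : set Cv) (act : A -> Cv -> Cv) : Prop := {
  am_0 : M 0;
  am_D : forall x y, M x -> M y -> M (x + y);
  am_act : forall a x, M x -> M (act a x);
  am_actDr : forall a x y, M x -> M y -> act a (x + y) = act a x + act a y;
  am_actDl : forall a b x, M x -> act (a + b) x = act a x + act b x;
  am_actM : forall a b x, M x -> act (a * b) x = act a (act b x);
  am_act1 : forall x, M x -> act 1 x = x }.

Definition Apairing (M M' : set Cv) (act act' : A -> Cv -> Cv)
    (b : Cv -> Cv -> A -> Fq) : Prop :=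
  [/\ forall x1 x2 y, M x1 -> M x2 -> M' y -> b (x1 + x2) y = b x1 y \+ b x2 y,
      forall x y1 y2, M x -> M' y1 -> M' y2 -> b x (y1 + y2) = b x y1 \+ b x y2 &
      forall a x y, M x -> M' y ->
        b (act a x) y = b x (act' a y) /\ b x (act' a y) = dscale a (b x y)].

(** [A]-linearity of a map on an [A]-module [M] inside [C], stated on the graphs
    of the operations because [set_type M] carries no algebraic structure. *)
Definition Alinear (M : set Cv) (act : A -> Cv -> Cv) (F : M -> (A -> Fq)) :
    Prop :=
  (forall x y z : M, \val z = \val x + \val y -> F z = F x \+ F y) /\
  (forall a (x y : M), \val y = act a (\val x) -> F y = dscale a (F x)).

(** [Hom_A(M, Hom_Fq(A, Fq))]: continuous [A]-linear maps, with the
    compact-open topology. *)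
Definition homA_set (M : set Cv) (act : A -> Cv -> Cv) :
    set {compact-open, M -> dual} :=
  [set F : M -> dual | continuous F /\ Alinear act (fun x => F x)].

Definition homA (M : set Cv) (act : A -> Cv -> Cv) : Type :=
  set_type (@homA_set M act).
HB.instance Definition _ M act := Topological.on (@homA M act).

Definition homA_fun (M : set Cv) (act : A -> Cv -> Cv) (F : homA M act) :
  M -> dual := \val F.
Coercion homA_fun : homA >-> Funclass.

(** Isomorphisms of topological [A]-modules
    [M -> Hom_A(M', Hom_Fq(A, Fq))]; the module structure of the target is
    pointwise. *)
Definition top_module_iso (M M' : set Cv) (act act' : A -> Cv -> Cv)
    (Phi : M -> homA M' act') : Prop :=
  (forall y : M', Alinear act (fun x => Phi x y)) /\
  (exists Psi : homA M' act' -> M,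
    [/\ cancel Phi Psi, cancel Psi Phi, continuous Phi & continuous Psi]).

End Series.

(* Main.v *)
Require Import Defs.
From HB Require Import structures.
From mathcomp Require Import all_boot all_order all_algebra all_field.
From mathcomp Require Import all_classical all_reals all_analysis.
From mathcomp Require Import zify ring lra.

Set Implicit Arguments.
Unset Strict Implicit.
Unset Printing Implicit Defensive.

Import Order.TTheory GRing.Theory Num.Theory.
Local Open Scope classical_set_scope.
Local Open Scope ring_scope.

(** Everything is governed by the absolute values [|f_n| r^(q^n)]. An everywhere
    convergent [f] solves [f(y) = w] with [|y| <= r] as soon as
    [|w| <= |f_k| r^(q^k)] for some [k]: for a truncation of [f] this is a
    statement about the roots of a polynomial, and the general case follows by
    successive approximation. The same truncations show that the balls of
    [ker f] are compact.

    Write [f o alpha = g o (1 - tau)], so that [<alpha, beta> = g^*(beta)]. If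
    [|f_n| |alpha|^(q^n) |beta| < 1] for all [n], then [g^*(beta)] is an element
    of [F_q] of absolute value [< 1], hence vanishes. If instead [alpha <> 0] and
    [|f_n| |alpha|^(q^n) s >= 1] for some [n], then [g^*(beta) = 1] has a solution
    with [|beta| <= s], and [alpha f^*(beta) = (1 - tau)^*(1) = 0] puts it in
    [ker f^*]. As [<alpha, beta>_f = - <beta, alpha>_(f^* )], the same holds with
    the roles of [f] and [f^*] exchanged: balls of [ker f] and of [ker f^*] are
    mutual annihilators, and linear algebra over [F_q] on their finite
    quotients yields the topological duality of [ker f] and [ker f^*]. The
    [A]-linear version follows by evaluating at [1] in [A]. *)

(** * Absolute values and powers of Frobenius *)

(** Since the exponent of [tau] runs over all of [Z], [ker f] is in general neither compact nor
    discrete, only locally compact, and a continuous functional cannot be represented in one step.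
    It is represented on one ball at a time, and the representing vectors are then shown to converge
    as the ball grows. The argument needs only a few metric facts about the pairing, isolated in
    [duality]. That record is symmetric in its two spaces, so each half of the statement is proved
    once. The threshold |f_n| r^(q^n) s >= 1 can serve both sides because its power of exponent
    q^(-n) is the same condition for the adjoint, with [r] and [s] exchanged. Radii are arbitrary
    real numbers, not values of [v]; once [everywhere_cvgP] is known, a trivial absolute value
    therefore needs no separate treatment. *)

Section AbsoluteValue.
Variables (R : realType) (C : closedFieldType) (v : nonarch_absval R C).
Implicit Types x y : C.

Lemma absv0 : v 0 = 0. Proof. exact/absv_eq0. Qed.

Lemma absv_gt0 x : (0 < v x) = (x != 0).
Proof.
rewrite lt0r absv_ge0 andbT.
have [->|x0] := eqVneq x 0; first by rewrite absv0 eqxx.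
by apply/eqP => /absv_eq0/eqP; rewrite (negPf x0).
Qed.

Lemma absv1 : v 1 = 1.
Proof.
have v1 : v 1 != 0 by rewrite gt_eqF // absv_gt0 oner_eq0.
by apply: (mulfI v1); rewrite -absvM !mulr1.
Qed.

Lemma absvX x n : v (x ^+ n) = v x ^+ n.
Proof.
by elim: n => [|n IH]; rewrite ?expr0 ?absv1 // !exprS absvM IH.
Qed.

Lemma absvD_lt x y (e : R) : v x < e -> v y < e -> v (x + y) < e.
Proof. by move=> xe ye; rewrite (le_lt_trans (absvD v x y)) // gt_max xe. Qed.

Lemma absvB_lt x y (e : R) : v x < e -> v y < e -> v (x - y) < e.
Proof. by move=> xe ye; rewrite absvD_lt // absvN. Qed.

Lemma absvD_le x y (e : R) : v x <= e -> v y <= e -> v (x + y) <= e.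
Proof. by move=> xe ye; rewrite (le_trans (absvD v x y)) // ge_max xe. Qed.

Lemma absvB_le x y (e : R) : v x <= e -> v y <= e -> v (x - y) <= e.
Proof. by move=> xe ye; rewrite absvD_le // absvN. Qed.

Lemma absv_sum_lt (I : Type) (r : seq I) (P : pred I) (F : I -> C) (e : R) :
  0 < e -> (forall i, P i -> v (F i) < e) -> v (\sum_(i <- r | P i) F i) < e.
Proof.
move=> e0 Fe; elim/big_ind: _ => //; first by rewrite absv0.
by move=> x y; exact: absvD_lt.
Qed.

Lemma absv_sum_le (I : Type) (r : seq I) (P : pred I) (F : I -> C) (e : R) :
  0 <= e -> (forall i, P i -> v (F i) <= e) -> v (\sum_(i <- r | P i) F i) <= e.
Proof.
move=> e0 Fe; elim/big_ind: _ => //; first by rewrite absv0.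
by move=> x y; exact: absvD_le.
Qed.

Lemma absv_eq0_lt x : (forall e, 0 < e -> v x < e) -> x = 0.
Proof.
move=> xe; apply/eqP/negPn/negP; rewrite -absv_gt0 => /xe.
by rewrite ltxx.
Qed.

Lemma absvDr_eq x y : v y < v x -> v (x + y) = v x.
Proof.
move=> yx; apply/le_anti/andP; split.
  by apply: absvD_le => //; exact: ltW.
rewrite leNgt; apply/negP => xyx.
have : v (x + y - y) < v x by exact: absvB_lt.
by rewrite addrK ltxx.
Qed.

End AbsoluteValue.

(** * Powers of Frobenius on [C] and on real radii *)

Section Frobenius.
Variables (R : realType) (Fq : finFieldType) (C : closedFieldType).
Variable v : nonarch_absval R C.
Variable iota : {rmorphism Fq -> C}.
Local Notation Cv := (valued v).
Local Notation q := #|Fq|.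

Lemma card_Fq_gt1 : (1 < q)%N. Proof. exact: finNzRing_gt1. Qed.

Lemma card_Fq_gt0 : (0 < q)%N. Proof. exact: ltnW card_Fq_gt1. Qed.

Lemma pchar_nat_card (m : nat) : ([char C].-nat (q ^ m))%N.
Proof.
have [p p_pr pF] := finPcharP Fq.
rewrite pnatX (card_pprimeChar pF) pnatX pnatE //.
by rewrite (fmorph_pchar iota) pF.
Qed.

Lemma qexpD (m : nat) (x y : C) :
  (x + y) ^+ (q ^ m) = x ^+ (q ^ m) + y ^+ (q ^ m).
Proof. exact/exprDn_pchar/pchar_nat_card. Qed.

Lemma qexp_gt0 (m : nat) : (0 < q ^ m)%N.
Proof. by rewrite expn_gt0 card_Fq_gt0. Qed.

Lemma qexpN (m : nat) (x : C) : (- x) ^+ (q ^ m) = - x ^+ (q ^ m).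
Proof.
apply/eqP; rewrite -addr_eq0 -qexpD addNr expr0n.
by rewrite (gtn_eqF (qexp_gt0 m)).
Qed.

Lemma qexp_inj (m : nat) : injective (fun x : C => x ^+ (q ^ m)).
Proof.
move=> x y /= xy; apply/eqP; rewrite -subr_eq0.
have /eqP : (x - y) ^+ (q ^ m) = 0 by rewrite qexpD qexpN xy subrr.
by rewrite expf_eq0 => /andP[].
Qed.

Lemma qexp_surj (m : nat) (z : C) : exists y : C, y ^+ (q ^ m) = z.
Proof.
have [y yE] := @solve_monicpoly C _ (fun i => if i == 0%N then z else 0)
  (qexp_gt0 m).
exists y; rewrite {}yE; case: (q ^ m)%N (qexp_gt0 m) => // n _.
rewrite big_ord_recl /= expr0 mulr1 big1 ?addr0 // => i _.
by rewrite mul0r.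
Qed.

(** Raising to a power [q ^ k] that clears the negative exponent removes the choice made in [qpow].
    This power map is injective, whence the converse [qpow_uniq]; the laws of [qpow] then reduce to
    those of natural powers. *)
Lemma qpow_exp (n : int) (k l : nat) (z : Cv) : n + k%:Z = l%:Z ->
  qpow Fq n z ^+ (q ^ k) = z ^+ (q ^ l).
Proof.
case: n => m /= nkl; first by rewrite -exprM -expnD; congr (z ^+ (q ^ _)); lia.
case: xgetP => [y _ /= <-|/(_ _)noy].
  by rewrite -exprM -expnD; congr (y ^+ (q ^ _)); lia.
by have [y yz] := qexp_surj m.+1 z; case: (noy y).
Qed.

Lemma qpow_uniq (n : int) (k l : nat) (y z : Cv) : n + k%:Z = l%:Z ->
  y ^+ (q ^ k) = z ^+ (q ^ l) -> y = qpow Fq n z.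
Proof.
by move=> nkl yz; apply: (@qexp_inj k); rewrite yz (qpow_exp _ nkl).
Qed.

Lemma int_shift_ge0 (n : int) : exists k l : nat, n + k%:Z = l%:Z.
Proof. by case: n => m; [exists 0%N, m | exists m.+1, 0%N]; lia. Qed.

Lemma qpowD (n : int) (x y : Cv) :
  qpow Fq n (x + y) = qpow Fq n x + qpow Fq n y.
Proof.
have [k [l nkl]] := int_shift_ge0 n; apply/esym/(qpow_uniq nkl).
by rewrite !qexpD !(qpow_exp _ nkl).
Qed.

Lemma qpowM (n : int) (x y : Cv) :
  qpow Fq n (x * y) = qpow Fq n x * qpow Fq n y.
Proof.
have [k [l nkl]] := int_shift_ge0 n; apply/esym/(qpow_uniq nkl).
by rewrite !exprMn !(qpow_exp _ nkl).
Qed.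

Lemma qpow0 (n : int) : qpow Fq n (0 : Cv) = 0.
Proof. by apply: (addrI (qpow Fq n (0 : Cv))); rewrite -qpowD !addr0. Qed.

Lemma qpow1 (n : int) : qpow Fq n (1 : Cv) = 1.
Proof.
have [k [l nkl]] := int_shift_ge0 n; apply/esym/(qpow_uniq nkl).
by rewrite !expr1n.
Qed.

Lemma qpowN (n : int) (x : Cv) : qpow Fq n (- x) = - qpow Fq n x.
Proof. by apply/eqP; rewrite -addr_eq0 -qpowD addNr qpow0. Qed.

Lemma qpowB (n : int) (x y : Cv) :
  qpow Fq n (x - y) = qpow Fq n x - qpow Fq n y.
Proof. by rewrite qpowD qpowN. Qed.

Lemma qpow_sum (n : int) (I : Type) (r : seq I) (F : I -> Cv) :
  qpow Fq n (\sum_(i <- r) F i) = \sum_(i <- r) qpow Fq n (F i).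
Proof.
by elim: r => [|i r IH]; rewrite ?big_nil ?qpow0 // !big_cons qpowD IH.
Qed.

Lemma qpow_id (z : Cv) : qpow Fq 0 z = z.
Proof. by rewrite /= expn0 expr1. Qed.

Lemma qpow_qpow (m n : int) (z : Cv) :
  qpow Fq m (qpow Fq n z) = qpow Fq (m + n) z.
Proof.
have [k [l mkl]] := int_shift_ge0 m; have [k' [l' nkl]] := int_shift_ge0 n.
apply: (@qpow_uniq _ (k + k') (l + l')); first by lia.
rewrite expnD exprM (qpow_exp _ mkl) exprAC (qpow_exp _ nkl).
by rewrite -exprM -expnD addnC.
Qed.

Lemma qpowK (n : int) : cancel (qpow Fq n : Cv -> Cv) (qpow Fq (- n)).
Proof. by move=> z; rewrite qpow_qpow addNr qpow_id. Qed.

Lemma qpow_iota (n : int) (c : Fq) : qpow Fq n (iota c : Cv) = iota c.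
Proof.
have cq m : c ^+ (q ^ m) = c.
  by elim: m => [|m IH]; rewrite ?expr1 // expnS exprM expf_card.
have [k [l nkl]] := int_shift_ge0 n; apply/esym/(qpow_uniq nkl).
by rewrite -!rmorphXn /= !cq.
Qed.

(** Over [Fq] the polynomial X^q - X is the product of all X - c, so it has no further roots in
    [C]. *)
Lemma iotaP (z : C) : z ^+ q = z -> exists c, iota c = z.
Proof.
move=> zq; have : (map_poly iota ('X^q - 'X)).[z] = 0.
  by rewrite rmorphB /= map_polyXn map_polyX !hornerE zq subrr.
rewrite finField_genPoly rmorph_prod horner_prod => /eqP/prodf_eq0[c _].
rewrite /= map_polyXsubC hornerXsubC subr_eq0 => /eqP ->.
by exists c.
Qed.

(** Real exponents give the size of [qpow n z] for negative [n] too, and make sense at radii that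
    are not values of [v]. *)
Definition rq (n : int) (x : R) : R := x `^ (q%:R ^ n).

Lemma rq_exp_gt0 (n : int) : 0 < (q%:R : R) ^ n.
Proof. by rewrite exprz_gt0 // ltr0n card_Fq_gt0. Qed.

Lemma rq_ge0 n x : 0 <= rq n x. Proof. exact: powR_ge0. Qed.

Lemma rq_gt0 n x : 0 < x -> 0 < rq n x. Proof. exact: powR_gt0. Qed.

Lemma rqM n x y : 0 <= x -> 0 <= y -> rq n (x * y) = rq n x * rq n y.
Proof. exact: powRM. Qed.

Lemma rq0 x : 0 <= x -> rq 0 x = x.
Proof. by move=> x0; rewrite /rq expr0z powRr1. Qed.

Lemma rq_rq m n x : rq m (rq n x) = rq (m + n) x.
Proof.
rewrite /rq -powRrM -expfzDr 1?addrC //.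
by rewrite pnatr_eq0 -lt0n card_Fq_gt0.
Qed.

Lemma rqK n x : 0 <= x -> rq (- n) (rq n x) = x.
Proof. by move=> x0; rewrite rq_rq addNr rq0. Qed.

Lemma rq_nat (n : nat) x : 0 <= x -> rq n%:Z x = x ^+ (q ^ n).
Proof. by move=> x0; rewrite /rq -exprnP -natrX powR_mulrn. Qed.

Lemma rq_le n x y : 0 <= x -> x <= y -> rq n x <= rq n y.
Proof.
move=> x0 xy; apply: ge0_ler_powR => //; first exact/ltW/rq_exp_gt0.
by rewrite nnegrE (le_trans x0).
Qed.

Lemma rq_lt n x y : 0 <= x -> x < y -> rq n x < rq n y.
Proof.
move=> x0 xy; apply: gt0_ltr_powR => //; first exact/rq_exp_gt0.
by rewrite nnegrE (le_trans x0) // ltW.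
Qed.

Lemma rq1 n : rq n 1 = 1. Proof. by rewrite /rq powR1. Qed.

Lemma rq00 n : rq n 0 = 0.
Proof. by rewrite /rq powR0 // gt_eqF // rq_exp_gt0. Qed.

Lemma absv_qpow n (z : Cv) : v (qpow Fq n z) = rq n (v z).
Proof.
have [k [l nkl]] := int_shift_ge0 n.
have vE : v (qpow Fq n z) ^+ (q ^ k) = v z ^+ (q ^ l).
  by rewrite -!absvX; congr (v _); exact: qpow_exp.
have v0 := absv_ge0 v (qpow Fq n z).
rewrite -(rqK k v0) rq_nat // vE -rq_nat ?absv_ge0 // rq_rq; congr rq.
by lia.
Qed.

End Frobenius.

(** * Sums over the integers *)

(** Built from the two half-sums of [zsum], whose second one starts at -1; hence the asymmetric
    window -N <= n < N. *)
Definition zwin (N : nat) : seq int :=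
  [seq n%:Z | n <- iota 0 N] ++ [seq - n.+1%:Z | n <- iota 0 N].

Lemma mem_zwin (N : nat) (n : int) : (n \in zwin N) = (- N%:Z <= n < N%:Z).
Proof.
rewrite mem_cat; apply/orP/idP => [[|] /mapP[m]|].
- by rewrite mem_iota => mN ->; lia.
- by rewrite mem_iota => mN ->; lia.
case: n => n nN; [left|right]; first by apply: map_f; rewrite mem_iota; lia.
by rewrite NegzE (map_f (fun n => - n.+1%:Z)) // mem_iota; lia.
Qed.

Lemma zwin_uniq (N : nat) : uniq (zwin N).
Proof.
rewrite cat_uniq !map_inj_uniq ?iota_uniq //=; last 2 first.
- by move=> m n; lia.
- by move=> m n; lia.
by rewrite andbT; apply/hasPn => _ /mapP[n _ ->]; apply/mapP => -[m _]; lia.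
Qed.

Lemma seq_sub_zwin (S : seq int) : exists N : nat, {subset S <= zwin N}.
Proof.
exists (\max_(n <- S) `|n|).+1%N => n nS; rewrite mem_zwin.
by have : (`|n| <= \max_(n <- S) `|n|)%N := leq_bigmax_seq _ nS isT; lia.
Qed.

(** * Families tending to zero along the cofinite filter *)

Section Vanishing.
Variables (R : realType) (C : closedFieldType) (v : nonarch_absval R C).
Local Notation Cv := (valued v).

Definition vanish (I : eqType) (u : I -> Cv) : Prop :=
  forall e : R, 0 < e -> exists S : seq I, forall i, i \notin S -> v (u i) < e.

Definition vanish2 (I J : eqType) (u : I -> J -> Cv) : Prop :=
  vanish (fun p : I * J => u p.1 p.2).

Lemma vanish_can (I J : eqType) (h : J -> I) (g : I -> J) (u : I -> Cv) :
  cancel h g -> vanish u -> vanish (u \o h).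
Proof.
move=> hK u0 e e0; have [S Su] := u0 e e0; exists (map g S) => j jS.
by apply: Su; apply: contra jS => hS; rewrite -(hK j) map_f.
Qed.

Lemma vanish_le (I : eqType) (u w : I -> Cv) :
  (forall i, v (u i) <= v (w i)) -> vanish w -> vanish u.
Proof.
move=> uw w0 e e0; have [S Sw] := w0 e e0; exists S => i /Sw.
exact: le_lt_trans.
Qed.

Lemma vanishD (I : eqType) (u w : I -> Cv) :
  vanish u -> vanish w -> vanish (fun i => u i + w i).
Proof.
move=> u0 w0 e e0; have [S Su] := u0 e e0; have [T Tw] := w0 e e0.
exists (S ++ T) => i; rewrite mem_cat negb_or => /andP[/Su ui /Tw wi].
exact: absvD_lt.
Qed.

Lemma vanishN (I : eqType) (u : I -> Cv) : vanish u -> vanish (fun i => - u i).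
Proof. by apply: vanish_le => i; rewrite absvN. Qed.

Lemma vanishZ (I : eqType) (c : Cv) (u : I -> Cv) :
  vanish u -> vanish (fun i => c * u i).
Proof.
move=> u0 e e0; have c0 : 0 < v c + 1 by rewrite ltr_wpDl ?absv_ge0.
have [S Su] := u0 (e / (v c + 1)) (divr_gt0 e0 c0); exists S => i /Su.
rewrite ltr_pdivlMr // absvM; apply: le_lt_trans.
by rewrite mulrC ler_wpM2l ?absv_ge0 // lerDl.
Qed.

Lemma vanish_fin (I : eqType) (S : seq I) (u : I -> Cv) :
  (forall i, i \notin S -> u i = 0) -> vanish u.
Proof. by move=> u0 e e0; exists S => i /u0 ->; rewrite absv0. Qed.

Lemma vanish_bounded (I : eqType) (u : I -> Cv) :
  vanish u -> exists2 M, 0 < M & forall i, v (u i) <= M.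
Proof.
move=> u0; have [S Su] := u0 1 ltr01.
exists (1 + \sum_(i <- S) v (u i)).
  by rewrite ltr_pwDl // sumr_ge0 // => i _; exact: absv_ge0.
move=> i; have [iS|/Su/ltW ui] := boolP (i \in S).
  rewrite (big_rem i) //= addrCA lerDl addr_ge0 // sumr_ge0 // => j _.
  exact: absv_ge0.
rewrite (le_trans ui) // lerDl sumr_ge0 // => j _.
exact: absv_ge0.
Qed.

(** Outside finitely many rows everything is small by the uniform bound, and each remaining row has
    only finitely many large entries. *)
Lemma vanish2_slice (I J : eqType) (u : I -> J -> Cv) :
  (forall i, vanish (u i)) ->
  (forall e : R, 0 < e -> exists S : seq I,
    forall i, i \notin S -> forall j, v (u i j) < e) ->
  vanish2 u.
Proof.
move=> ui u0 e e0; have [S Su] := u0 e e0.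
have [T Tu] : exists T : seq (I * J), forall i j, i \in S -> (i, j) \notin T ->
    v (u i j) < e.
  elim: S {Su} => [|i S [T IH]]; first by exists [::].
  have [Ti Tiu] := ui i e e0; exists ([seq (i, j) | j <- Ti] ++ T) => i' j.
  rewrite mem_cat negb_or inE => iS /andP[ijT ijT'].
  case/predU1P: iS ijT ijT' => [-> jT _|/IH iS _]; last exact: iS.
  by apply: Tiu; apply: contra jT; exact: map_f.
exists T => -[i j] ijT /=; have [iS|/Su] := boolP (i \in S); last exact.
exact: Tu.
Qed.

Lemma vanish2_row (I J : eqType) (u : I -> J -> Cv) i :
  vanish2 u -> vanish (u i).
Proof.
move=> u0 e e0; have [S Su] := u0 e e0; exists (map snd S) => j jS.
by apply: (Su (i, j)); apply: contra jS => /(map_f snd).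
Qed.

Lemma vanish2C (I J : eqType) (u : I -> J -> Cv) :
  vanish2 u -> vanish2 (fun j i => u i j).
Proof.
move=> u0; apply: (@vanish_can _ _ (fun p => (p.2, p.1)) (fun p => (p.2, p.1))
  (fun p : I * J => u p.1 p.2)) => // -[j i] //.
Qed.

End Vanishing.

Section IntegerSums.
Variables (R : realType) (C : closedFieldType) (v : nonarch_absval R C).
Hypothesis complete_v : absv_complete v.
Local Notation Cv := (valued v).
Implicit Types u w : int -> Cv.

Lemma nat_series_cvg (w : nat -> Cv) :
  (forall e : R, 0 < e -> exists N : nat, forall n, (N <= n)%N -> v (w n) < e) ->
  cvgn (series w).
Proof.
move=> w0; apply: complete_v; apply: cauchy_exP => e e0.
have [N wN] := w0 e e0; exists (series w N); exists N => // n /= Nn.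
rewrite /ball /= /absv_ball /series /= -(subnKC Nn) /index_iota subn0 subn0.
rewrite iotaD big_cat /= opprD addNKr absvN big_seq.
by apply: absv_sum_lt => // i; rewrite mem_iota => /andP[/wN].
Qed.

Lemma nat_series_term (w : nat -> Cv) e : cvgn (series w) -> 0 < e ->
  exists N : nat, forall n, (N <= n)%N -> v (w n) < e.
Proof.
move=> /cvg_ballP /(_ e) + e0 => /(_ e0)[N _ wN]; exists N => n Nn.
have := wN n Nn; have := wN n.+1 (leqW Nn).
rewrite /ball /= /absv_ball /series /= big_nat_recr //=.
set l := lim _; set s := \sum_(_ <= _ < _) _ => ln1 ln.
have -> : w n = (l - s) - (l - (s + w n)) by ring.
exact: absvB_lt.
Qed.

Lemma big_zwin u (K : nat) : \sum_(n <- zwin K) u n =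
  series (fun n : nat => u n%:Z) K + series (fun n : nat => u (- n.+1%:Z)) K.
Proof. by rewrite /zwin big_cat !big_map /series /= /index_iota subn0. Qed.

(** In a complete ultrametric field a series converges as soon as its terms tend to 0. This
    criterion ignores the order of summation, so sums over [Z] can be reindexed and exchanged
    freely. *)
Lemma zcvgP u : zcvg u <-> vanish u.
Proof.
split=> [[cp cn] e e0|u0].
  have [N Nu] := nat_series_term cp e0; have [M Mu] := nat_series_term cn e0.
  exists (zwin (maxn N M)); case=> n; rewrite mem_zwin => nNM.
    by apply: Nu; lia.
  by rewrite NegzE; apply: Mu; lia.
split; apply: nat_series_cvg => e e0; have [S Su] := u0 e e0;
  have [N NS] := seq_sub_zwin S; exists N => n Nn; apply: Su;
  by apply/negP => /NS; rewrite mem_zwin; lia.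
Qed.

(** By the ultrametric inequality the error of a finite partial sum is controlled by the omitted
    terms alone, whatever finite set is summed. The identities between sums below rest on this
    estimate. *)
Lemma zsum_approx u (S : seq int) e : vanish u -> 0 < e -> uniq S ->
  (forall n, n \notin S -> v (u n) < e) -> v (zsum u - \sum_(n <- S) u n) < e.
Proof.
move=> /zcvgP[cp cn] e0 uS Su; rewrite /zsum.
move: cp cn => /cvg_ballP/(_ e e0)[N _ Np] /cvg_ballP/(_ e e0)[M _ Mn].
set l := limn _ in Np *; set l' := limn _ in Mn *.
have [L SL] := seq_sub_zwin S; pose K := maxn (maxn N M) L.
have := Np K; rewrite /= /K !leq_max leqnn => /(_ isT).
have := Mn K; rewrite /= /K !leq_max leqnn orbT => /(_ isT).
rewrite -/K /ball /= /absv_ball => l'e le.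
have ST n : n \in S -> n \in zwin K by move=> /SL; rewrite !mem_zwin; lia.
have := big_zwin u K.
set p := series _ K in le *; set p' := series _ K in l'e * => zE.
have -> : l + l' - \sum_(n <- S) u n =
    (l - p) + (l' - p') + \sum_(n <- zwin K | n \notin S) u n.
  have : \sum_(n <- zwin K) u n =
      \sum_(n <- S) u n + \sum_(n <- zwin K | n \notin S) u n.
    rewrite (bigID (mem S)) /=; congr (_ + _).
    rewrite -big_filter; apply: perm_big; apply: uniq_perm => //.
      exact/filter_uniq/zwin_uniq.
    by move=> n; rewrite mem_filter andb_idr // => /ST.
  rewrite zE => sT.
  have -> : \sum_(n <- S) u n = p + p' - \sum_(n <- zwin K | n \notin S) u n.
    by rewrite sT addrK.
  by ring.
by apply: absvD_lt; [exact: absvD_lt|apply: absv_sum_lt => // i /Su].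
Qed.

Lemma zsum_lt u e : vanish u -> 0 < e -> (forall n, v (u n) < e) ->
  v (zsum u) < e.
Proof.
move=> u0 e0 ue; have := @zsum_approx u [::] e u0 e0 isT.
by rewrite big_nil subr0; apply=> n _.
Qed.

Lemma zsum_fin u (S : seq int) : uniq S -> (forall n, n \notin S -> u n = 0) ->
  zsum u = \sum_(n <- S) u n.
Proof.
move=> uS Su; apply/eqP; rewrite -subr_eq0; apply/eqP.
apply: (@absv_eq0_lt _ _ v) => e e0; apply: zsum_approx => //.
  exact: vanish_fin Su.
by move=> n /Su ->; rewrite absv0.
Qed.

Lemma zsum_uniq u (s : Cv) : vanish u ->
  (forall e : R, 0 < e -> exists2 S : seq int, uniq S &
    (forall n, n \notin S -> v (u n) < e) /\ v (s - \sum_(n <- S) u n) < e) ->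
  zsum u = s.
Proof.
move=> u0 us; apply/eqP; rewrite -subr_eq0; apply/eqP.
apply: (@absv_eq0_lt _ _ v) => e e0; have [S uS [Su sS]] := us e e0.
have -> : zsum u - s =
  (zsum u - \sum_(n <- S) u n) - (s - \sum_(n <- S) u n) by ring.
by apply: absvB_lt => //; exact: zsum_approx.
Qed.

Lemma vanish_uniq (I : eqType) (u : I -> Cv) e : vanish u -> 0 < e ->
  exists2 S : seq I, uniq S & forall i, i \notin S -> v (u i) < e.
Proof.
move=> u0 e0; have [S Su] := u0 e e0; exists (undup S); first exact: undup_uniq.
by move=> i; rewrite mem_undup => /Su.
Qed.

Lemma zsumD u w : vanish u -> vanish w ->
  zsum (fun n => u n + w n) = zsum u + zsum w.
Proof.
move=> u0 w0; apply: zsum_uniq; first exact: vanishD.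
move=> e e0; have [S Su] := u0 e e0; have [T Tw] := w0 e e0.
have Ue n : n \notin undup (S ++ T) -> v (u n) < e.
  by rewrite mem_undup mem_cat negb_or => /andP[/Su].
have We n : n \notin undup (S ++ T) -> v (w n) < e.
  by rewrite mem_undup mem_cat negb_or => /andP[_ /Tw].
exists (undup (S ++ T)); first exact: undup_uniq.
split=> [n nST|]; first by apply: absvD_lt; [exact: Ue|exact: We].
rewrite big_split /= opprD addrACA.
by apply: absvD_lt; apply: zsum_approx; rewrite ?undup_uniq.
Qed.

Lemma zsumZ (c : Cv) u : vanish u -> zsum (fun n => c * u n) = c * zsum u.
Proof.
move=> u0; apply: zsum_uniq; first exact: vanishZ.
move=> e e0; have c0 : 0 < v c + 1 by rewrite ltr_wpDl ?absv_ge0.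
have ce (x : Cv) : v x < e / (v c + 1) -> v (c * x) < e.
  rewrite ltr_pdivlMr // absvM; apply: le_lt_trans.
  by rewrite mulrC ler_wpM2l ?absv_ge0 // lerDl.
have [S uS Su] := vanish_uniq u0 (divr_gt0 e0 c0).
exists S => //; split=> [n /Su|]; first exact: ce.
rewrite -mulr_sumr -mulrBr; apply: ce.
by apply: zsum_approx => //; exact: divr_gt0.
Qed.

Lemma zsumN u : vanish u -> zsum (fun n => - u n) = - zsum u.
Proof.
move=> u0; rewrite -mulN1r -zsumZ //.
by congr zsum; apply/funext => n; rewrite mulN1r.
Qed.

Lemma zsumB u w : vanish u -> vanish w ->
  zsum (fun n => u n - w n) = zsum u - zsum w.
Proof. by move=> u0 w0; rewrite zsumD ?zsumN //; exact: vanishN. Qed.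

Lemma zsum_reindex (h g : int -> int) u : cancel h g -> cancel g h ->
  vanish u -> zsum (u \o h) = zsum u.
Proof.
move=> hK gK u0; apply: zsum_uniq; first exact: vanish_can hK u0.
move=> e e0; have [S uS Su] := vanish_uniq u0 e0; exists (map g S).
  by rewrite map_inj_uniq //; exact: can_inj gK.
have gS n : n \notin map g S -> h n \notin S.
  by apply: contra => nS; rewrite -(hK n) map_f.
split=> [n /gS/Su //|].
rewrite big_map (eq_bigr u) => [|i _]; first exact: zsum_approx.
by rewrite /= gK.
Qed.

Lemma zsum_shift (k : int) u : vanish u -> zsum (fun n => u (n + k)) = zsum u.
Proof.
apply: (@zsum_reindex (fun n => n + k) (fun n => n - k)) => n;
by rewrite ?addrK ?subrK.
Qed.

Lemma vanish_zsum (I : eqType) (u : I -> int -> Cv) :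
  vanish2 u -> vanish (fun i => zsum (u i)).
Proof.
move=> u0 e e0; have [S Su] := u0 e e0; exists (map fst S) => i iS.
apply: zsum_lt => //; first exact: vanish2_row u0.
by move=> j; apply: (Su (i, j)); apply: contra iS => /(map_f fst).
Qed.

Lemma zsum_exchange (u : int -> int -> Cv) : vanish2 u ->
  zsum (fun i => zsum (u i)) = zsum (fun j => zsum (u^~ j)).
Proof.
move=> u0; apply: zsum_uniq; first exact: vanish_zsum.
move=> e e0; have [S Su] := u0 e e0.
pose S1 := undup (map fst S); pose S2 := undup (map snd S).
have S1u i j : i \notin S1 -> v (u i j) < e.
  rewrite mem_undup => iS; apply: (Su (i, j)).
  by apply: contra iS => /(map_f fst).
have S2u i j : j \notin S2 -> v (u i j) < e.
  rewrite mem_undup => jS; apply: (Su (i, j)).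
  by apply: contra jS => /(map_f snd).
have u0' := vanish2C u0.
exists S1; [exact: undup_uniq|split].
  move=> i iS; apply: zsum_lt => // [|j]; last exact: S1u.
  exact: vanish2_row u0.
(* Both iterated sums are compared with the finite sum over [S1] x [S2]. The three errors come from
   columns outside [S2], column entries outside [S1] and row entries outside [S2]. *)
have -> : zsum (fun j => zsum (u^~ j)) - \sum_(i <- S1) zsum (u i) =
   (zsum (fun j => zsum (u^~ j)) - \sum_(j <- S2) zsum (u^~ j)) +
   \sum_(j <- S2) (zsum (u^~ j) - \sum_(i <- S1) u i j) -
   \sum_(i <- S1) (zsum (u i) - \sum_(j <- S2) u i j).
  by rewrite !sumrB exchange_big /=; ring.
apply: absvB_lt; first apply: absvD_lt.
- apply: zsum_approx => //; first exact: vanish_zsum u0'.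
    exact: undup_uniq.
  move=> j jS; apply: zsum_lt => // [|i]; last exact: S2u.
  exact: (vanish2_row _ u0').
- apply: absv_sum_lt => // j _; apply: zsum_approx; rewrite ?undup_uniq //.
    exact: (vanish2_row _ u0').
  by move=> i; exact: S1u.
- apply: absv_sum_lt => // i _; apply: zsum_approx; rewrite ?undup_uniq //.
    exact: (vanish2_row _ u0).
  by move=> j; exact: S2u.
Qed.

End IntegerSums.

(** * The ring of everywhere convergent series *)

Section SeriesRing.
Variables (R : realType) (Fq : finFieldType) (C : closedFieldType).
Variable v : nonarch_absval R C.
Hypothesis complete_v : absv_complete v.
Variable iota : {rmorphism Fq -> C}.
Local Notation Cv := (valued v).
Local Notation q := #|Fq|.
Local Notation qpow := (@qpow R Fq C v).
Local Notation rq := (rq Fq).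
Local Notation feval := (@feval R Fq C v).
Local Notation fcomp := (@fcomp R Fq C v).
Local Notation fadj := (@fadj R Fq C v).
Local Notation fseries := (fseries v).
Implicit Types f g h u : fseries.

(** The working form of [everywhere_cvg]: it involves only the sizes of the coefficients and
    quantifies over all real radii. *)
Definition entire f : Prop := forall r : R, 0 <= r -> forall e : R, 0 < e ->
  exists S : seq int, forall n, n \notin S -> v (f n) * rq n r < e.

Lemma exprn_unbounded (x r : R) : 1 < x -> exists n, r <= x ^+ n.
Proof.
move=> x1; have x10 : 0 < x - 1 by rewrite subr_gt0.
have bern n : 1 + n%:R * (x - 1) <= x ^+ n.
  elim: n => [|n IH]; first by rewrite mul0r addr0.
  rewrite exprS (le_trans _ (ler_wpM2l _ IH)) //; last by rewrite ltW // (lt_trans _ x1).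
  have nx : 0 <= n%:R * (x - 1) * (x - 1) by rewrite !mulr_ge0 // ltW.
  by rewrite -natr1; lra.
have [n nr] : exists n : nat, `|r| / (x - 1) < n%:R.
  by exists (Num.bound (`|r| / (x - 1))); rewrite archi_boundP // divr_ge0 // ltW.
exists n; rewrite (le_trans (ler_norm r)) // (le_trans _ (bern n)) //.
by move: nr; rewrite ltr_pdivrMr // => /ltW nr; rewrite (le_trans nr) // lerDr.
Qed.

Lemma entire_term f (z : Cv) : entire f -> vanish (fun n => f n * qpow n z).
Proof.
move=> fE e e0; have [S Sf] := fE (v z) (absv_ge0 _ _) e e0.
by exists S => n /Sf; rewrite absvM absv_qpow.
Qed.

(* If [v] is bounded then it is trivial, and the series is a Laurent
   polynomial. *)
Lemma everywhere_cvgP f : everywhere_cvg Fq f <-> entire f.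
Proof.
split=> [fE r r0 e e0|fE z]; last exact/(zcvgP complete_v)/entire_term.
have {}fE z : vanish (fun n => f n * qpow n z) by exact/(zcvgP complete_v)/fE.
have [[z rz]|nr] := pselect (exists z : C, r <= v z).
  have [S Sf] := fE z e e0; exists S => n /Sf; apply: le_lt_trans.
  by rewrite absvM absv_qpow ler_wpM2l ?absv_ge0 // rq_le.
have v1 (z : C) : v z <= 1.
  rewrite leNgt; apply/negP => z1; apply: nr.
  by have [n rn] := exprn_unbounded r z1; exists (z ^+ n); rewrite absvX.
have [S Sf] := fE 1 1 ltr01; exists S => n /Sf.
rewrite (qpow1 v iota) mulr1 => fn1.
have -> : v (f n) = 0; last by rewrite mul0r.
apply/eqP; rewrite eq_le absv_ge0 andbT leNgt absv_gt0; apply/negP => fn0.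
have := v1 (f n)^-1; rewrite leNgt => /negP; apply.
by rewrite -(ltr_pM2l (_ : 0 < v (f n))) ?absv_gt0 // -absvM divff // absv1 mulr1.
Qed.

Lemma entire_bounded f r : 0 <= r -> entire f ->
  exists2 M, 0 < M & forall n, v (f n) * rq n r <= M.
Proof.
move=> r0 fE; have [S Sf] := fE r r0 1 ltr01.
pose t n := v (f n) * rq n r.
have t0 n : 0 <= t n by rewrite mulr_ge0 ?absv_ge0 ?rq_ge0.
exists (1 + \sum_(i <- S) t i); first by rewrite ltr_pwDl // sumr_ge0.
move=> i; have [iS|/Sf/ltW ui] := boolP (i \in S).
  by rewrite (big_rem i) //= addrCA lerDl addr_ge0 // sumr_ge0.
by rewrite (le_trans ui) // lerDl sumr_ge0.
Qed.

Lemma entire_vanish f (w : int -> Cv) r :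
  entire f -> (forall n, v (w n) <= r) -> vanish (fun n => f n * qpow n (w n)).
Proof.
move=> fE wr e e0.
have r0 : 0 <= r := le_trans (absv_ge0 v (w 0)) (wr 0).
have [S Sf] := fE r r0 e e0; exists S => n /Sf; apply: le_lt_trans.
by rewrite absvM absv_qpow ler_wpM2l ?absv_ge0 // rq_le // absv_ge0.
Qed.

Lemma vanish_coef f : entire f -> vanish f.
Proof.
move=> fE; have := entire_term 1 fE; congr vanish; apply/funext => n.
by rewrite (qpow1 v iota) mulr1.
Qed.

Lemma vanish_qpow m (u : int -> Cv) : vanish u -> vanish (fun n => qpow m (u n)).
Proof.
move=> u0 e e0; have [S Su] := u0 (rq (- m) e) (rq_gt0 _ _ e0).
exists S => n /Su; rewrite absv_qpow => un.
rewrite -[ltRHS](@rqK _ Fq (- m)) ?ltW // opprK.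
exact: rq_lt (absv_ge0 _ _) un.
Qed.

Lemma qpow_zsum m (u : int -> Cv) : vanish u ->
  qpow m (zsum u) = zsum (fun n => qpow m (u n)).
Proof.
move=> u0; apply/esym/(zsum_uniq complete_v); first exact: vanish_qpow.
move=> e e0; have e'0 : 0 < rq (- m) e by exact: rq_gt0.
have lte (x : Cv) : v x < rq (- m) e -> v (qpow m x) < e.
  move=> xe; rewrite absv_qpow -[ltRHS](@rqK _ Fq (- m)) ?ltW // opprK.
  exact: rq_lt (absv_ge0 _ _) xe.
have [S uS Su] := vanish_uniq u0 e'0; exists S => //; split.
  by move=> n /Su; exact: lte.
rewrite -(qpow_sum iota) -(qpowB iota); apply: lte.
exact: zsum_approx.
Qed.

Lemma fevalD f x y : entire f -> feval f (x + y) = feval f x + feval f y.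
Proof.
move=> fE; rewrite /feval -(zsumD complete_v); try exact: entire_term.
by congr zsum; apply/funext => n; rewrite (qpowD iota) mulrDr.
Qed.

Lemma feval0 f : feval f 0 = 0.
Proof.
rewrite /feval (zsum_fin complete_v (S := [::])) ?big_nil // => n _.
by rewrite (qpow0 v iota) mulr0.
Qed.

Lemma fevalN f x : entire f -> feval f (- x) = - feval f x.
Proof.
by move=> fE; apply/eqP; rewrite -addr_eq0 -fevalD // addNr feval0.
Qed.

Lemma fevalB f x y : entire f -> feval f (x - y) = feval f x - feval f y.
Proof. by move=> fE; rewrite fevalD // fevalN. Qed.

Lemma feval_iota f c x : entire f -> feval f (iota c * x) = iota c * feval f x.
Proof.
move=> fE; rewrite /feval -(zsumZ complete_v); last exact: entire_term.
by congr zsum; apply/funext => n; rewrite (qpowM iota) (qpow_iota v iota) mulrCA.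
Qed.

Lemma feval_lt f z e : entire f -> 0 < e ->
  (forall n, v (f n) * rq n (v z) < e) -> v (feval f z) < e.
Proof.
move=> fE e0 fe; apply: zsum_lt => //; first exact: entire_term.
by move=> n; rewrite absvM absv_qpow.
Qed.

Lemma comp_vanish2 f (w : int -> Cv) : entire f -> vanish w ->
  vanish2 (fun i j => f i * qpow i (w j)).
Proof.
move=> fE w0; apply: vanish2_slice => [i|e e0].
  exact/vanishZ/vanish_qpow.
have [M M0 wM] := vanish_bounded w0; have [S Sf] := fE M (ltW M0) e e0.
exists S => i /Sf + j; apply: le_lt_trans.
by rewrite absvM absv_qpow ler_wpM2l ?absv_ge0 // rq_le // absv_ge0.
Qed.

Lemma feval_zsum f (w : int -> Cv) : entire f -> vanish w ->
  feval f (zsum w) = zsum (fun j => feval f (w j)).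
Proof.
move=> fE w0; rewrite /feval -(zsum_exchange complete_v); last exact: comp_vanish2.
congr zsum; apply/funext => i.
by rewrite (zsumZ complete_v) ?qpow_zsum //; exact: vanish_qpow.
Qed.

(** From the indices (n, i) of the coefficient formula for [fcomp] to the exponents (i, n - i) of
    the two factors. *)
Let shear (p : int * int) := (p.2, p.1 - p.2).

Let shearK : cancel shear (fun p => (p.1 + p.2, p.1)).
Proof. by move=> [a b]; rewrite /= addrC subrK. Qed.

Lemma comp_diag_vanish2 f g z : entire f -> entire g ->
  vanish2 (fun n i => f i * qpow i (g (n - i)) * qpow n z).
Proof.
move=> fE gE.
have /(vanish_can shearK) := comp_vanish2 fE (entire_term z gE).
congr vanish; apply/funext => -[n i] /=.
by rewrite (qpowM iota) mulrA (qpow_qpow iota) addrCA subrr addr0.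
Qed.

Lemma comp_coef_vanish f g n : entire f -> entire g ->
  vanish (fun i => f i * qpow i (g (n - i))).
Proof.
move=> fE gE; have := vanish2_row n (comp_diag_vanish2 1 fE gE).
by congr vanish; apply/funext => i; rewrite (qpow1 v iota) mulr1.
Qed.

Lemma fcomp_termE f g z n : entire f -> entire g ->
  fcomp f g n * qpow n z = zsum (fun i => f i * qpow i (g (n - i)) * qpow n z).
Proof.
move=> fE gE; rewrite mulrC -(zsumZ complete_v); last exact: comp_coef_vanish.
by congr zsum; apply/funext => i; rewrite mulrC.
Qed.

Lemma entire_fcomp f g : entire f -> entire g -> entire (fcomp f g).
Proof.
move=> fE gE; apply/everywhere_cvgP => z; apply/(zcvgP complete_v).
have := vanish_zsum complete_v (comp_diag_vanish2 z fE gE).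
by congr vanish; apply/funext => n; rewrite fcomp_termE.
Qed.

Lemma feval_fcomp f g z : entire f -> entire g ->
  feval (fcomp f g) z = feval f (feval g z).
Proof.
move=> fE gE; rewrite [feval g z]/(zsum _) (feval_zsum fE (entire_term z gE)).
rewrite -[RHS](zsum_exchange complete_v (comp_vanish2 fE (entire_term z gE))).
transitivity (zsum (fun n => zsum (fun i => f i * qpow i (g (n - i)) * qpow n z))).
  by congr zsum; apply/funext => n; rewrite fcomp_termE.
rewrite (zsum_exchange complete_v (comp_diag_vanish2 z fE gE)).
congr zsum; apply/funext => i.
rewrite -[RHS](zsum_shift complete_v (- i)); last first.
  exact: (vanish2_row _ (comp_vanish2 fE (entire_term z gE))).
congr zsum; apply/funext => n.
by rewrite (qpowM iota) mulrA (qpow_qpow iota) addrCA subrr addr0.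
Qed.

Lemma fcompA f g h : entire f -> entire g -> entire h ->
  fcomp (fcomp f g) h = fcomp f (fcomp g h).
Proof.
move=> fE gE hE; apply/funext => n.
have [M M0 hM] := vanish_bounded (vanish_coef hE).
have [M' M'0 gM] := entire_bounded (ltW M0) gE.
have glM i l : v (g l * qpow l (h (n - i - l))) <= M'.
  rewrite absvM absv_qpow (le_trans _ (gM l)) //.
  by rewrite ler_wpM2l ?absv_ge0 // rq_le // absv_ge0.
(* Both bracketings sum this family: the right one by rows, the left one along the diagonals i + l =
   k. The bound [M'], uniform in both indices, is what makes it vanish as a double family. *)
pose w i l := f i * qpow i (g l * qpow l (h (n - i - l))).
have w0 : vanish2 w.
  apply: vanish2_slice => [i|e e0].
    by apply/vanishZ/vanish_qpow; apply: entire_vanish gE _ => l; exact: hM.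
  have [S Sf] := fE M' (ltW M'0) e e0; exists S => i /Sf + l; apply: le_lt_trans.
  by rewrite absvM absv_qpow ler_wpM2l ?absv_ge0 // rq_le // absv_ge0.
have w0' : vanish2 (fun k i => w i (k - i)) := vanish_can shearK w0.
have -> : fcomp f (fcomp g h) n = zsum (fun i => zsum (w i)).
  congr zsum; apply/funext => i.
  have ghv : vanish (fun l => g l * qpow l (h (n - i - l))).
    by apply: entire_vanish gE _ => l; exact: hM.
  by rewrite (qpow_zsum _ ghv) (zsumZ complete_v) //; exact: vanish_qpow.
transitivity (zsum (fun k => zsum (fun i => w i (k - i)))).
  congr zsum; apply/funext => k; rewrite mulrC -(zsumZ complete_v).
    congr zsum; apply/funext => i; rewrite /w (qpowM iota) (qpow_qpow iota).
    have -> : i + (k - i) = k by rewrite addrCA subrr addr0.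
    have -> : n - i - (k - i) = n - k by rewrite opprB addrA subrK.
    by rewrite mulrC mulrA.
  exact: comp_coef_vanish.
rewrite (zsum_exchange complete_v w0'); congr zsum; apply/funext => i.
exact: (zsum_shift complete_v (- i) (vanish2_row i w0)).
Qed.

Lemma entireD f g : entire f -> entire g -> entire (fun n => f n + g n).
Proof.
move=> fE gE r r0 e e0.
have [S Sf] := fE r r0 e e0; have [T Tg] := gE r r0 e e0.
exists (S ++ T) => n; rewrite mem_cat negb_or => /andP[/Sf fn /Tg gn].
apply: le_lt_trans (_ : Num.max (v (f n)) (v (g n)) * rq n r < e).
  by rewrite ler_wpM2r ?rq_ge0 // absvD.
by case: (leP (v (f n)) (v (g n))).
Qed.

Lemma entireN f : entire f -> entire (fun n => - f n).
Proof.
move=> fE r r0 e e0; have [S Sf] := fE r r0 e e0; exists S => n.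
by rewrite absvN; exact: Sf.
Qed.

Lemma entireB f g : entire f -> entire g -> entire (fun n => f n - g n).
Proof. by move=> fE /entireN; exact: entireD. Qed.

Lemma entire_fin f (S : seq int) : (forall n, n \notin S -> f n = 0) -> entire f.
Proof.
by move=> f0 r r0 e e0; exists S => n /f0 ->; rewrite absv0 mul0r.
Qed.

Lemma entire_fconst (c : Cv) : entire (fconst c).
Proof.
apply: (@entire_fin _ [:: 0]) => n; rewrite inE /fconst.
by case: eqP.
Qed.

Lemma entire_ftau : entire (ftau v).
Proof.
apply: (@entire_fin _ [:: 1]) => n; rewrite inE /ftau.
by case: eqP.
Qed.

Lemma fevalDl f g z : entire f -> entire g ->
  feval (fun n => f n + g n) z = feval f z + feval g z.
Proof.
move=> fE gE; rewrite /feval -(zsumD complete_v); try exact: entire_term.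
by congr zsum; apply/funext => n; rewrite mulrDl.
Qed.

Lemma fcompDl f g h : entire f -> entire g -> entire h ->
  fcomp (fun n => f n + g n) h = (fun n => fcomp f h n + fcomp g h n).
Proof.
move=> fE gE hE; apply/funext => n; rewrite -(zsumD complete_v).
- by congr zsum; apply/funext => i; rewrite mulrDl.
- exact: comp_coef_vanish.
- exact: comp_coef_vanish.
Qed.

Lemma fcompDr f g h : entire f -> entire g -> entire h ->
  fcomp f (fun n => g n + h n) = (fun n => fcomp f g n + fcomp f h n).
Proof.
move=> fE gE hE; apply/funext => n; rewrite -(zsumD complete_v).
- by congr zsum; apply/funext => i; rewrite (qpowD iota) mulrDr.
- exact: comp_coef_vanish.
- exact: comp_coef_vanish.
Qed.

Lemma feval_fconst (c z : Cv) : feval (fconst c) z = c * z.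
Proof.
rewrite /feval (zsum_fin complete_v (S := [:: 0])) //.
  by rewrite big_seq1 /fconst eqxx (qpow_id Fq).
by move=> n; rewrite inE /fconst => /negPf ->; rewrite mul0r.
Qed.

Lemma fcomp_constr f (c : Cv) : fcomp f (fconst c) = (fun n => f n * qpow n c).
Proof.
apply/funext => n; rewrite /fcomp (zsum_fin complete_v (S := [:: n])) //.
  by rewrite big_seq1 subrr /fconst eqxx.
move=> i; rewrite inE /fconst subr_eq0 eq_sym => /negPf ->.
by rewrite (qpow0 v iota) mulr0.
Qed.

Lemma absv_fadj f n : v (fadj f n) = rq n (v (f (- n))).
Proof. by rewrite /fadj absv_qpow. Qed.

(** Adjunction exchanges the roles of radius and tolerance: after taking the power of exponent
    q^(-n), the bound for radius [r] and tolerance [e] becomes |f_(-n)| (1/e)^(q^(-n)) < 1/r. Since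
    [r] may be 0, [r + 1] is used in its place. *)
Lemma entire_fadj f : entire f -> entire (fadj f).
Proof.
move=> fE r r0 e e0; have r1 : 0 < r + 1 by rewrite ltr_wpDl.
have e'0 : 0 < e^-1 by rewrite invr_gt0.
have r'0 : 0 < (r + 1)^-1 by rewrite invr_gt0.
have [S Sf] := fE e^-1 (ltW e'0) _ r'0.
exists (map -%R S) => n nS; rewrite absv_fadj -rqM ?absv_ge0 //.
rewrite -[e]invrK -[e^-1](@rqK _ Fq (- n)) ?invr_ge0 ?ltW // opprK.
have fn : v (f (- n)) * rq (- n) e^-1 < (r + 1)^-1.
  by apply: Sf; apply: contra nS => nS; rewrite -[n]opprK map_f.
set x := rq (- n) e^-1 in fn *.
have x0 : 0 < x by rewrite rq_gt0 // invr_gt0.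
have fr1 : v (f (- n)) * r * x < 1.
  move: fn; rewrite -[_^-1]mul1r ltr_pdivlMr //; apply: le_lt_trans.
  by rewrite mulrAC ler_wpM2l ?mulr_ge0 ?absv_ge0 ?lerDl // ltW.
have fr0 : 0 <= v (f (- n)) * r by rewrite mulr_ge0 ?absv_ge0.
have := rq_lt Fq n (mulr_ge0 fr0 (ltW x0)) fr1.
rewrite rq1 (rqM Fq n fr0 (ltW x0)) => H.
by rewrite -[ltRHS]mul1r ltr_pdivlMr // rq_gt0.
Qed.

Lemma fadjK f : fadj (fadj f) = f.
Proof. by apply/funext => n; rewrite /fadj opprK (qpow_qpow iota) subrr (qpow_id Fq). Qed.

Lemma fadjD f g : fadj (fun n => f n + g n) = (fun n => fadj f n + fadj g n).
Proof. by apply/funext => n; rewrite /fadj (qpowD iota). Qed.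

Lemma fadj_fconst (c : Cv) : fadj (fconst c) = fconst c.
Proof.
apply/funext => n; rewrite /fadj /fconst oppr_eq0.
by case: eqP => [->|_]; rewrite ?(qpow_id Fq) ?(qpow0 v iota).
Qed.

Lemma fadj_fcomp f g : entire f -> entire g ->
  fadj (fcomp f g) = fcomp (fadj g) (fadj f).
Proof.
move=> fE gE; apply/funext => m; rewrite /fadj /fcomp.
have fgv := comp_coef_vanish (- m) fE gE.
rewrite (qpow_zsum _ fgv) -(zsum_shift complete_v (- m) (vanish_qpow m fgv)).
congr zsum; apply/funext => k.
rewrite (qpowM iota) !(qpow_qpow iota) mulrC.
by congr (qpow _ (g _) * qpow _ (f _)); ring.
Qed.

Lemma rq_mono (m n : int) (x : R) : 1 <= x -> m <= n -> rq m x <= rq n x.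
Proof.
move=> x1 mn; apply: ler_powR => //; apply: ler_weXz2l => //.
by rewrite ler1n card_Fq_gt0.
Qed.

(** * Division by [1 - tau] *)

Definition one_sub_tau : fseries := fun n => fconst 1 n - ftau v n.

Lemma entire_one_sub_tau : entire one_sub_tau.
Proof. by apply: entireB; [exact: entire_fconst|exact: entire_ftau]. Qed.

Lemma fcomp_one_sub_tau g : fcomp g one_sub_tau = (fun n => g n - g (n - 1)).
Proof.
apply/funext => n; rewrite /fcomp (zsum_fin complete_v (S := [:: n; n - 1])) //.
- have t0 : one_sub_tau 0 = 1 by rewrite /one_sub_tau /fconst /ftau /= subr0.
  have t1 : one_sub_tau 1 = -1 by rewrite /one_sub_tau /fconst /ftau /= sub0r.
  have n1 : n - (n - 1) = 1 by lia.
  rewrite big_cons big_seq1 subrr n1 t0 t1 (qpowN iota) !(qpow1 v iota).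
  by rewrite mulrN !mulr1.
- by rewrite /= inE; lia.
- move=> i; rewrite !inE negb_or => /andP[i1 i2].
  rewrite /one_sub_tau /fconst /ftau ifF; last by lia.
  by rewrite ifF ?subr0 ?(qpow0 v iota) ?mulr0 //; lia.
Qed.

(** A constant family tending to 0 is 0. This is the injectivity of the difference operator on
    coefficients, hence the uniqueness of quotients by [1 - tau]. *)
Lemma vanish_const (d : int -> Cv) :
  vanish d -> (forall n, d (n + 1) = d n) -> forall n, d n = 0.
Proof.
move=> d0 dS n.
have dk (k : nat) : d n = d (n + k%:Z).
  elim: k => [|k ->]; first by rewrite addr0.
  by rewrite -dS; congr d; lia.
apply: (@absv_eq0_lt _ _ v) => e e0; have [S Sd] := d0 e e0.
have [N SN] := seq_sub_zwin S.
rewrite (dk (`|n| + N)%N); apply: Sd; apply/negP => /SN.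
by rewrite mem_zwin; lia.
Qed.

Lemma one_sub_tau_cancel g h : entire g -> entire h ->
  fcomp g one_sub_tau = fcomp h one_sub_tau -> g = h.
Proof.
move=> gE hE; rewrite !fcomp_one_sub_tau => gh; apply/funext => n.
apply/eqP; rewrite -subr_eq0; apply/eqP.
apply: (vanish_const (vanish_coef (entireB gE hE))) => {}n.
have := congr1 (fun f => f (n + 1)) gh; rewrite /= addrK => ghn.
have -> : g (n + 1) = h (n + 1) - h n + g n by rewrite -ghn subrK.
by ring.
Qed.

(** Right composition with [1 - tau] takes differences of consecutive coefficients, so the quotient
    of [u] consists of its partial sums. *)
Definition fquo u : fseries := fun n => zsum (fun i => if i <= n then u i else 0).

Lemma vanish_if (P : pred int) (u : int -> Cv) :
  vanish u -> vanish (fun i => if P i then u i else 0).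
Proof.
apply: vanish_le => i; case: ifP => // _.
by rewrite absv0 absv_ge0.
Qed.

Lemma fquo_tail u n : vanish u -> zsum u = 0 ->
  fquo u n = - zsum (fun i => if n < i then u i else 0).
Proof.
move=> u0 su; apply/eqP; rewrite -addr_eq0 -(zsumD complete_v); last 2 first.
- exact: vanish_if.
- exact: vanish_if.
apply/eqP; rewrite -[RHS]su; congr zsum; apply/funext => i.
by case: ifP => ni; case: ifP => ni'; rewrite ?addr0 ?add0r //; lia.
Qed.

(** For n < 0 the partial sum only involves small early terms, and r'^(q^n) <= r'. For n >= 0 the
    vanishing of the total sum turns it into minus a tail, whose terms carry the larger weights
    r'^(q^i), i > n. Both comparisons need r' >= 1, whence the maximum with 1. *)
Lemma entire_fquo u : entire u -> zsum u = 0 -> entire (fquo u).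
Proof.
move=> uE su r r0 e e0; have u0 := vanish_coef uE.
pose r' := Num.max r 1; have r'1 : 1 <= r' by rewrite /r' le_max lexx orbT.
have r'0 : 0 < r' by rewrite (lt_le_trans ltr01).
have [S Su] := uE r' (ltW r'0) e e0.
have [T Tu] := u0 _ (divr_gt0 e0 r'0).
have [N SN] := seq_sub_zwin (S ++ T); exists (zwin N) => n nN.
have ui i : (i < - N%:Z) || (N%:Z <= i) -> i \notin S ++ T.
  by move=> iN; apply/negP => /SN; rewrite mem_zwin; lia.
apply: le_lt_trans (_ : v (fquo u n) * rq n r' < e).
  by rewrite ler_wpM2l ?absv_ge0 // rq_le // /r' le_max lexx.
have rn0 : 0 < rq n r' by rewrite rq_gt0.
rewrite -ltr_pdivlMr //; have en0 := divr_gt0 e0 rn0.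
have [n0|n0] := ltP n 0.
  apply: zsum_lt => //; first exact: vanish_if.
  move=> i; case: ifP => [ni|_]; last by rewrite absv0.
  have /ui : (i < - N%:Z) || (N%:Z <= i) by move: nN; rewrite mem_zwin; lia.
  rewrite mem_cat negb_or => /andP[_ /Tu] /lt_le_trans; apply.
  rewrite ler_pM2l // lef_pV2 ?posrE // -[leRHS](rq0 Fq (ltW r'0)).
  by rewrite rq_mono // ltW.
rewrite fquo_tail // absvN; apply: zsum_lt => //; first exact: vanish_if.
move=> i; case: ifP => [ni|_]; last by rewrite absv0.
have /ui : (i < - N%:Z) || (N%:Z <= i) by move: nN; rewrite mem_zwin; lia.
rewrite mem_cat negb_or => /andP[/Su ie _]; rewrite ltr_pdivlMr //.
apply: le_lt_trans ie; rewrite ler_wpM2l ?absv_ge0 // rq_mono //.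
exact: ltW.
Qed.

Lemma fquoK u : vanish u -> fcomp (fquo u) one_sub_tau = u.
Proof.
move=> u0; rewrite fcomp_one_sub_tau; apply/funext => n.
rewrite -(zsumB complete_v); try exact: vanish_if.
rewrite (zsum_fin complete_v (S := [:: n])) //.
  by rewrite big_seq1 lexx ifF ?subr0 //; lia.
move=> i; rewrite inE => ni; case: ifP => ini; case: ifP => ini';
by rewrite ?subrr //; lia.
Qed.

End SeriesRing.

(** * Solving [f(y) = w] and finiteness of kernels *)

(** A fragment of the theory of Newton polygons: multiplication by X - z with |z| > rho preserves
    the strict dominance of the constant term on the disc of radius rho, so one can induct on the
    linear factors. *)
Lemma coef_lt_of_roots_gt (R : realType) (C : closedFieldType)
    (v : nonarch_absval R C) (p : {poly C}) (rho : R) : 0 <= rho -> p != 0 ->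
  (forall x, root p x -> rho < v x) ->
  forall k, (0 < k)%N -> v p`_k * rho ^+ k < v p`_0.
Proof.
move=> rho0 p0 pr k k0; have [rs pE] := closed_field_poly_normal p.
have lc0 : lead_coef p != 0 by rewrite lead_coef_eq0.
have {}pr z : z \in rs -> rho < v z.
  by move=> zrs; apply: pr; rewrite pE rootZ // root_prod_XsubC.
suff [_ H] : 0 < v (\prod_(z <- rs) ('X - z%:P))`_0 /\ forall k, (0 < k)%N ->
    v (\prod_(z <- rs) ('X - z%:P))`_k * rho ^+ k <
    v (\prod_(z <- rs) ('X - z%:P))`_0.
  by rewrite pE !coefZ !absvM -mulrA ltr_pM2l ?absv_gt0 // H.
elim: rs pr {pE} => [|z rs IH] pr.
  rewrite big_nil; split=> [|[|j] // _]; first by rewrite coef1 absv_gt0 oner_eq0.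
  by rewrite !coef1 absv0 mul0r absv_gt0 oner_eq0.
have [|P0 IHk] := IH; first by move=> x xrs; apply: pr; rewrite inE xrs orbT.
have rz : rho < v z by apply: pr; rewrite mem_head.
have z0 : 0 < v z := le_lt_trans rho0 rz.
rewrite big_cons; set P := \prod_(_ <- _) _ in P0 IHk *.
have E0 : v (('X - z%:P) * P)`_0 = v z * v P`_0.
  by rewrite mulrBl coefB coefXM /= coefCM sub0r absvN absvM.
rewrite E0; split=> [|[//|j] _]; first by rewrite mulr_gt0.
rewrite mulrBl coefB coefXM /= coefCM.
have Pj : v P`_j * rho ^+ j <= v P`_0.
  by case: j => [|j]; [rewrite expr0 mulr1|exact/ltW/IHk].
have [->|rn0] := eqVneq rho 0; first by rewrite exprS mul0r mulr0 mulr_gt0.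
have rp : 0 < rho by rewrite lt_def rn0.
rewrite -ltr_pdivlMr ?exprn_gt0 //; apply: absvB_lt.
  rewrite ltr_pdivlMr ?exprn_gt0 // exprSr mulrA mulrC.
  by rewrite (le_lt_trans (ler_wpM2l rho0 Pj)) // ltr_pM2r.
by rewrite ltr_pdivlMr ?exprn_gt0 // absvM -mulrA ltr_pM2l // IHk.
Qed.

Section Solve.
Variables (R : realType) (Fq : finFieldType) (C : closedFieldType).
Variable v : nonarch_absval R C.
Hypothesis complete_v : absv_complete v.
Variable iota : {rmorphism Fq -> C}.
Local Notation Cv := (valued v).
Local Notation q := #|Fq|.
Local Notation qpow := (@qpow R Fq C v).
Local Notation rq := (rq Fq).
Local Notation feval := (@feval R Fq C v).
Local Notation fseries := (fseries v).
Local Notation entire := (@entire R Fq C v).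
Implicit Types f : fseries.

Definition ftrunc (N : nat) f (z : Cv) : Cv :=
  \sum_(n <- zwin N) f n * qpow n z.

(** The substitution z = x^(q^N) makes the exponents q^n with n >= -N integral, so the truncation
    becomes a polynomial. As [qpow N] is bijective, zeros correspond. *)
Definition trunc_poly (N : nat) f : {poly C} :=
  \sum_(n <- zwin N) f n *: 'X^(q ^ `|n + N%:Z|).

Lemma horner_trunc_poly N f (x : C) :
  (trunc_poly N f).[x] = ftrunc N f (qpow N%:Z x).
Proof.
rewrite /trunc_poly horner_sum /ftrunc big_seq [RHS]big_seq.
apply: eq_bigr => n; rewrite mem_zwin => /andP[nN _].
rewrite hornerZ hornerXn (qpow_qpow iota).
by have -> : n + N%:Z = (absz (n + N%:Z))%:Z by lia.
Qed.

Lemma coef_trunc_poly N f k : k \in zwin N ->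
  (trunc_poly N f)`_(q ^ `|k + N%:Z|) = f k.
Proof.
move=> kN; rewrite /trunc_poly coef_sum (bigD1_seq k) ?zwin_uniq //=.
rewrite coefZ coefXn eqxx mulr1 big_seq_cond big1 ?addr0 // => n /andP[nN nk].
rewrite coefZ coefXn eqn_exp2l ?card_Fq_gt1 //.
rewrite (_ : (_ == _) = false) ?mulr0 //.
by move: kN nN; rewrite !mem_zwin; lia.
Qed.

Lemma coef0_trunc_poly N f : (trunc_poly N f)`_0 = 0.
Proof.
rewrite /trunc_poly coef_sum big1 // => n _; rewrite coefZ coefXn.
by rewrite eq_sym (gtn_eqF (qexp_gt0 _ _)) mulr0.
Qed.

Lemma ftruncB N f x y : ftrunc N f (x - y) = ftrunc N f x - ftrunc N f y.
Proof.
by rewrite /ftrunc -sumrB; apply: eq_bigr => n _; rewrite (qpowB iota) mulrBr.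
Qed.

Lemma ftrunc0 N f : ftrunc N f 0 = 0.
Proof. by have := ftruncB N f 0 0; rewrite !subrr. Qed.

(** If the polynomial minus [w] had no root of size at most r^(q^(-N)), its constant term would
    strictly dominate the term of degree q^(k+N) on that disc, which says |f_k| r^(q^k) < |w|. *)
Lemma ftrunc_solve N f k (w : Cv) r : k \in zwin N -> 0 <= r ->
  v w <= v (f k) * rq k r -> exists2 y : Cv, v y <= r & ftrunc N f y = w.
Proof.
move=> kN r0 wk; have [->|w0] := eqVneq w 0.
  by exists 0; rewrite ?absv0 ?ftrunc0.
pose P := trunc_poly N f - w%:P; pose rho := rq (- N%:Z) r.
have P0 : P`_0 = - w by rewrite coefB coef0_trunc_poly coefC /= sub0r.
have [[x [xP xr]]|noroot] := pselect (exists x, root P x /\ v x <= rho).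
  exists (qpow N%:Z x).
    rewrite absv_qpow -[leRHS](@rqK _ Fq (- N%:Z)) // opprK.
    exact: rq_le (absv_ge0 _ _) xr.
  apply/eqP; rewrite -subr_eq0 -horner_trunc_poly.
  by move: xP; rewrite /root hornerD hornerN hornerC.
exfalso; have := wk; rewrite leNgt => /negP; apply.
have := @coef_lt_of_roots_gt _ _ v P rho (rq_ge0 _ _ _) _ _
  (expn q `|k + N%:Z|) (qexp_gt0 _ _).
rewrite P0 absvN coefB coef_trunc_poly // coefC (gtn_eqF (qexp_gt0 _ _)) subr0.
rewrite -rq_nat ?rq_ge0 // rq_rq.
have -> : (absz (k + N%:Z))%:Z - N%:Z = k by move: kN; rewrite mem_zwin; lia.
apply.
  by apply/eqP => PE; move/eqP: P0; rewrite PE coef0 eq_sym oppr_eq0 (negPf w0).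
by move=> x xP; rewrite ltNge; apply/negP => xr; apply: noroot; exists x.
Qed.

Lemma ftrunc_ker_finite N f k : k \in zwin N -> f k != 0 ->
  exists s : seq C, forall y : Cv, ftrunc N f y = 0 -> (y : C) \in s.
Proof.
move=> kN fk; have P0 : trunc_poly N f != 0.
  apply: contra fk => /eqP PE.
  by rewrite -(coef_trunc_poly f kN) PE coef0.
have [rs PE] := closed_field_poly_normal (trunc_poly N f).
exists (map (qpow N%:Z) rs) => y y0.
rewrite -[y](qpowK iota (- N%:Z)) opprK map_f //.
have : root (trunc_poly N f) (qpow (- N%:Z) y).
  rewrite /root horner_trunc_poly -[X in qpow X]opprK.
  by rewrite (qpowK iota (- N%:Z)) y0.
by rewrite PE rootZ ?lead_coef_eq0 // root_prod_XsubC.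
Qed.

Lemma ftrunc_approx N f z e : entire f -> 0 < e ->
  (forall n, n \notin zwin N -> v (f n) * rq n (v z) < e) ->
  v (feval f z - ftrunc N f z) < e.
Proof.
move=> fE e0 fe; apply: zsum_approx => //; first exact: entire_term.
  exact: zwin_uniq.
by move=> n /fe; rewrite absvM absv_qpow.
Qed.

Lemma feval_small f e : entire f -> 0 < e ->
  exists2 d, 0 < d & forall x : Cv, v x < d -> v (feval f x) < e.
Proof.
move=> fE e0; have [S Sf] := fE 1 ler01 e e0.
have [d [d0 d1] Sd] : exists2 d, 0 < d /\ d <= 1 &
    forall n, n \in S -> v (f n) * rq n d < e.
  elim: S {Sf} => [|n S [d [d0 d1] Sd]]; first by exists 1.
  have fn0 : 0 < v (f n) + 1 by rewrite ltr_wpDl ?absv_ge0.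
  pose d' := rq (- n) (e / (v (f n) + 1)).
  have d'0 : 0 < d' by rewrite rq_gt0 // divr_gt0.
  have m0 : 0 <= Num.min d d' by rewrite le_min !ltW.
  exists (Num.min d d') => [|m].
    by rewrite lt_min d0 d'0 ge_min d1.
  rewrite inE => /predU1P[->|/Sd]; last first.
    apply: le_lt_trans; rewrite ler_wpM2l ?absv_ge0 // rq_le //.
    by rewrite ge_min lexx.
  apply: le_lt_trans (_ : v (f n) * rq n d' < e).
    by rewrite ler_wpM2l ?absv_ge0 // rq_le // ge_min lexx orbT.
  rewrite -[X in rq X]opprK rqK; last by rewrite divr_ge0 // ltW.
  rewrite mulrA ltr_pdivrMr // mulrC ltr_pM2l //.
  by rewrite ltrDl.
exists d => // x xd; apply: feval_lt => // n.
have xn : rq n (v x) <= rq n d by rewrite rq_le ?absv_ge0 // ltW.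
have [/Sd|/Sf] := boolP (n \in S); apply: le_lt_trans; rewrite ler_wpM2l ?absv_ge0 //.
by rewrite (le_trans xn) // rq_le // ltW.
Qed.

Lemma seq_limit (y : nat -> Cv) :
  (forall e, 0 < e -> exists N : nat, forall n, (N <= n)%N -> v (y n) < e) ->
  exists L : Cv, forall e, 0 < e -> exists N : nat, forall n, (N <= n)%N ->
    v (L - \sum_(i < n) y i) < e.
Proof.
move=> /(nat_series_cvg complete_v) yc; exists (limn (series y)) => e e0.
have /cvg_ballP/(_ e e0)[N _ yN] := yc; exists N => n /yN.
by rewrite /ball /= /absv_ball /series /= big_mkord.
Qed.

Lemma halves_small (r e : R) : 0 < e -> exists N : nat, forall n, (N <= n)%N ->
  r / 2 ^+ n < e.
Proof.
move=> e0; have [N rN] := exprn_unbounded ((r + 1) / e) (ltr1n R 2).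
exists N => n Nn; rewrite ltr_pdivrMr ?exprn_gt0 // mulrC.
move: rN; rewrite ler_pdivrMr // => rN.
rewrite (@lt_le_trans _ _ (r + 1)) ?ltrDl // (le_trans rN) // ler_pM2r //.
by rewrite ler_eXn2l // ltr1n.
Qed.

Lemma entire_solve f k (w : Cv) r : entire f -> 0 <= r ->
  v w <= v (f k) * rq k r -> exists2 y : Cv, v y <= r & feval f y = w.
Proof.
move=> fE r0 wk; have [->|w0] := eqVneq w 0.
  by exists 0; rewrite ?absv0 // (feval0 complete_v iota).
have : 0 < v (f k) * rq k r by rewrite (lt_le_trans _ wk) // absv_gt0.
have [->|rn0] := eqVneq r 0; first by rewrite rq00 mulr0 ltxx.
have {rn0} r1 : 0 < r by rewrite lt_def rn0.
rewrite pmulr_lgt0 ?rq_gt0 // => fk.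
have rj j : 0 < r / 2 ^+ j by rewrite divr_gt0 // exprn_gt0.
(* The residual at stage [j] is just small enough for a correction of size at most [r / 2 ^ j]. The
   index [k] stays fixed while the window grows, so that the truncation error already meets the
   bound of stage [j + 1]. *)
pose ok j (s : Cv) := v (w - feval f s) <= v (f k) * rq k (r / 2 ^+ j).
(* The invariant stands under the existential so that [choice] yields a total step function. *)
have step (p : nat * Cv) : exists y : Cv, ok p.1 p.2 ->
    v y <= r / 2 ^+ p.1 /\ ok p.1.+1 (p.2 + y).
  case: p => j s /=; have [oks|] := pselect (ok j s); last by exists 0.
  pose e := v (f k) * rq k (r / 2 ^+ j.+1).
  have e0 : 0 < e by rewrite mulr_gt0 // rq_gt0.
  have [S Sf] := fE _ (ltW (rj j)) e e0.
  have [N SN] := seq_sub_zwin (k :: S).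
  have [y yr yw] := ftrunc_solve (SN k (mem_head _ _)) (ltW (rj j)) oks.
  exists y => _; split => //; rewrite /ok (fevalD complete_v iota) //.
  have -> : w - (feval f s + feval f y) = - (feval f y - ftrunc N f y).
    by rewrite yw; ring.
  rewrite absvN; apply/ltW/ftrunc_approx => // n nN.
  have nS : n \notin S by apply: contra nN => nS; apply: SN; rewrite inE nS orbT.
  apply: le_lt_trans (Sf n nS); rewrite ler_wpM2l ?absv_ge0 //.
  by rewrite rq_le ?absv_ge0.
have [F FP] := choice step.
pose s := fix s n := if n is m.+1 then s m + F (m, s m) else 0.
have sok n : ok n (s n).
  elim: n => [|n IH] /=; last by have [] := FP (n, s n) IH.
  by rewrite /ok (feval0 complete_v iota) subr0 expr0 divr1.
pose y n := F (n, s n).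
have yr n : v (y n) <= r / 2 ^+ n by have [] := FP (n, s n) (sok n).
have sE n : s n = \sum_(i < n) y i.
  by elim: n => [|n IH]; rewrite ?big_ord0 // big_ord_recr /= -IH.
have [|L LP] := @seq_limit y.
  move=> e e0; have [N Ne] := halves_small r e0.
  by exists N => n /Ne; exact: le_lt_trans.
have sr n : v (s n) <= r.
  rewrite sE; apply: absv_sum_le => // i _; rewrite (le_trans (yr i)) //.
  by rewrite ler_pdivrMr ?exprn_gt0 // ler_peMr // exprn_ege1 // ler1n.
exists L.
  have [N /(_ N (leqnn N)) LN] := LP r r1; rewrite -sE in LN.
  by rewrite -[L](subrK (s N)); apply: absvD_le => //; exact: ltW.
apply/eqP; rewrite -subr_eq0; apply/eqP.
apply: (@absv_eq0_lt _ _ v) => e e0.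
have [d d0 fd] := feval_small fE e0; have [N LN] := LP d d0.
have fk1 : 0 < v (f k) + 1 by rewrite ltr_wpDl // ltW.
have e'0 : 0 < rq (- k) (e / (v (f k) + 1)) by rewrite rq_gt0 // divr_gt0.
have [M rM] := halves_small r e'0; pose n := maxn N M.
have -> : feval f L - w = feval f (L - s n) - (w - feval f (s n)).
  by rewrite (fevalB complete_v iota) //; ring.
apply: absvB_lt; first by apply: fd; rewrite sE; apply: LN; exact: leq_maxl.
rewrite (le_lt_trans (sok n)) //.
have /(rq_lt Fq k (ltW (rj n))) := rM n (leq_maxr _ _).
rewrite -[X in _ < _ X _]opprK rqK; last by rewrite divr_ge0 // ltW.
rewrite ltr_pdivlMr // mulrC; apply: le_lt_trans.
by rewrite ler_wpM2r ?rq_ge0 // lerDl.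
Qed.

(** On a zero of [f] in the ball the truncation is small, so a correction of size at most [d / 2]
    leads to one of the finitely many zeros of the truncation. *)
Lemma ker_precompact f k r d : entire f -> f k != 0 -> 0 <= r -> 0 < d ->
  exists s : seq C, forall z : Cv, feval f z = 0 -> v z <= r ->
    exists2 x, x \in s & v (z - x) < d.
Proof.
move=> fE fk r0 d0; pose e := v (f k) * rq k (d / 2).
have d20 : 0 < d / 2 by rewrite divr_gt0.
have e0 : 0 < e by rewrite mulr_gt0 ?absv_gt0 // rq_gt0.
have [S Sf] := fE r r0 e e0; have [N SN] := seq_sub_zwin (k :: S).
have kN := SN k (mem_head _ _).
have [s sP] := ftrunc_ker_finite kN fk; exists s => z fz zr.
have tz : v (ftrunc N f z) < e.
  rewrite -absvN -[X in v X]add0r -fz; apply: ftrunc_approx => // n nN.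
  have nS : n \notin S by apply: contra nN => nS; apply: SN; rewrite inE nS orbT.
  apply: le_lt_trans (Sf n nS); rewrite ler_wpM2l ?absv_ge0 //.
  by rewrite rq_le ?absv_ge0.
have [y yd yz] := ftrunc_solve kN (ltW d20) (ltW tz).
exists (z - y); first by apply: sP; rewrite ftruncB yz subrr.
by rewrite subKr (le_lt_trans yd) // ltr_pdivrMr // ltr_pMr // ltr1n.
Qed.

End Solve.

(** * The pairing *)

Section Pairing.
Variables (R : realType) (Fq : finFieldType) (C : closedFieldType).
Variable v : nonarch_absval R C.
Hypothesis complete_v : absv_complete v.
Variable iota : {rmorphism Fq -> C}.
Local Notation Cv := (valued v).
Local Notation q := #|Fq|.
Local Notation qpow := (@qpow R Fq C v).
Local Notation rq := (rq Fq).
Local Notation feval := (@feval R Fq C v).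
Local Notation fcomp := (@fcomp R Fq C v).
Local Notation fadj := (@fadj R Fq C v).
Local Notation fker := (@fker R Fq C v).
Local Notation fdiv := (@fdiv R Fq C v).
Local Notation pairing := (@pairing R Fq C v iota).
Local Notation fseries := (fseries v).
Local Notation entire := (@entire R Fq C v).
Local Notation tm := (one_sub_tau v).
Implicit Types f g h u : fseries.

Let adjE f : entire f -> entire (fadj f). Proof. exact: entire_fadj. Qed.
Let constE (c : Cv) : entire (fconst c). Proof. exact: entire_fconst. Qed.
Let tmE : entire tm. Proof. exact: entire_one_sub_tau. Qed.
Let compE f g : entire f -> entire g -> entire (fcomp f g).
Proof. exact: (entire_fcomp complete_v iota). Qed.
Local Hint Extern 0 (entire _) => solve [repeat first
  [assumption | simple apply adjE | simple apply constE | simple apply tmE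
  | simple apply compE]] : core.

Lemma fkerE f z : fker f z = (feval f z = 0). Proof. by []. Qed.

Lemma fevalE f z : feval f z = zsum (fun n => f n * qpow n z).
Proof. by []. Qed.

(* Distinct values of [feval] or [pairing] are very slow to compare by
   conversion; this is why some rewriting below is done with [etrans]. *)
Local Opaque Defs.feval Defs.fker.

Lemma fkerD f x y : entire f -> fker f x -> fker f y -> fker f (x + y).
Proof.
move=> fE; rewrite !fkerE => fx fy.
by rewrite (fevalD complete_v iota) // fx fy addr0.
Qed.

Lemma fkerZ f c x : entire f -> fker f x -> fker f (iota c * x).
Proof.
by move=> fE; rewrite !fkerE (feval_iota complete_v) // => ->; rewrite mulr0.
Qed.

Lemma fker0 f : fker f 0. Proof. by rewrite fkerE (feval0 complete_v iota). Qed.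

Lemma fdiv_uniq f g alpha : entire g -> fcomp f (fconst alpha) = fcomp g tm ->
  fdiv f alpha = g.
Proof.
move=> gE fg; rewrite /fdiv; case: xgetP => [g' _ /= [g'E fg']|/(_ g)[]].
  apply: (one_sub_tau_cancel complete_v iota) => //.
    exact/(everywhere_cvgP complete_v iota).
  by rewrite -fg.
by split=> //; exact/(everywhere_cvgP complete_v iota).
Qed.

Lemma one_sub_tau_div u : entire u -> zsum u = 0 ->
  exists2 g, entire g & u = fcomp g tm.
Proof.
move=> uE u0; exists (fquo u); first exact: entire_fquo.
by rewrite (fquoK complete_v iota (vanish_coef iota uE)).
Qed.

Lemma fdiv_ex f alpha : entire f -> fker f alpha ->
  exists2 g, entire g & fcomp f (fconst alpha) = fcomp g tm.
Proof.
move=> fE fa; apply: one_sub_tau_div => //.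
by rewrite (fcomp_constr complete_v iota) -fevalE -fkerE.
Qed.

Lemma feval_fadj_tm x : feval (fadj tm) x = x - qpow (-1) x.
Proof.
have t0 : tm 0 = 1 by rewrite /one_sub_tau /fconst /ftau /= subr0.
have t1 : tm 1 = -1 by rewrite /one_sub_tau /fconst /ftau /= sub0r.
rewrite fevalE (zsum_fin complete_v (S := [:: 0; -1])) //.
  rewrite big_cons big_seq1 /fadj opprK oppr0 t0 t1 !(qpowN iota).
  by rewrite !(qpow1 v iota) (qpow_id Fq) mul1r mulN1r.
move=> n; rewrite !inE negb_or => /andP[n0 n1].
rewrite /fadj /one_sub_tau /fconst /ftau ifF; last by lia.
by rewrite ifF ?subr0 ?(qpow0 v iota) ?mul0r //; lia.
Qed.

(** The adjoint of f o alpha = g o (1 - tau), applied to [beta]. For [beta] in the kernel of the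
    adjoint of [f] it shows that the pairing is fixed by Frobenius, hence lies in [Fq]; conversely,
    a Frobenius-fixed value and alpha <> 0 force [beta] into that kernel. *)
Lemma fdiv_adjoint f g alpha beta : entire f -> entire g ->
  fcomp f (fconst alpha) = fcomp g tm ->
  feval (fadj g) beta - qpow (-1) (feval (fadj g) beta) =
  alpha * feval (fadj f) beta.
Proof.
move=> fE gE fg; rewrite -feval_fadj_tm -(feval_fcomp complete_v iota) //.
rewrite -(fadj_fcomp complete_v iota) // -fg (fadj_fcomp complete_v iota) //.
rewrite (feval_fcomp complete_v iota) // (fadj_fconst iota).
by rewrite (feval_fconst Fq complete_v).
Qed.

Lemma pairing_uniq f g alpha beta c : entire g ->
  fcomp f (fconst alpha) = fcomp g tm -> iota c = feval (fadj g) beta ->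
  pairing f alpha beta = c.
Proof.
move=> gE fg cE; rewrite /pairing (fdiv_uniq gE fg).
by case: xgetP => [d _ /= dE|/(_ c)[]//]; apply: (fmorph_inj iota); exact: etrans dE _.
Qed.

Lemma pairing_val f g alpha beta : entire f -> entire g ->
  fcomp f (fconst alpha) = fcomp g tm -> fker (fadj f) beta ->
  iota (pairing f alpha beta) = feval (fadj g) beta.
Proof.
move=> fE gE fg fb.
have [c cx] : exists c, iota c = feval (fadj g) beta.
  apply: iotaP; have /eqP := fdiv_adjoint beta fE gE fg.
  move: fb; rewrite fkerE => ->; rewrite mulr0 subr_eq0 => /eqP.
  move: (feval (fadj g) beta) => x xE.
  by rewrite {1}xE -[in RHS](qpow_id Fq x) -(subrr (1 : int)) -(qpow_qpow iota) /= expn1.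
exact: etrans (congr1 iota (pairing_uniq gE fg cx)) cx.
Qed.

Local Opaque Defs.pairing Defs.fdiv.

Lemma pairingDl f a1 a2 beta : entire f -> fker f a1 -> fker f a2 ->
  fker (fadj f) beta -> pairing f (a1 + a2) beta = pairing f a1 beta + pairing f a2 beta.
Proof.
move=> fE f1 f2 fb.
have [g1 gE1 gt1] := fdiv_ex fE f1; have [g2 gE2 gt2] := fdiv_ex fE f2.
apply: (@pairing_uniq _ (fun n => g1 n + g2 n)); first exact: entireD.
  rewrite (fcompDl complete_v iota) //.
  rewrite -gt1 -gt2 !(fcomp_constr complete_v iota).
  by apply/funext => n; rewrite (qpowD iota) mulrDr.
rewrite (fadjD iota) (fevalDl complete_v) //; apply: etrans (rmorphD iota _ _) _.
exact: (congr2 +%R (pairing_val fE gE1 gt1 fb) (pairing_val fE gE2 gt2 fb)).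
Qed.

Lemma pairingDr f alpha b1 b2 : entire f -> fker f alpha ->
  fker (fadj f) b1 -> fker (fadj f) b2 ->
  pairing f alpha (b1 + b2) = pairing f alpha b1 + pairing f alpha b2.
Proof.
move=> fE fa f1 f2; have [g gE gt] := fdiv_ex fE fa.
apply: (pairing_uniq gE gt); rewrite (fevalD complete_v iota) //.
apply: etrans (rmorphD iota _ _) _.
exact: (congr2 +%R (pairing_val fE gE gt f1) (pairing_val fE gE gt f2)).
Qed.

Lemma pairingZr f c alpha beta : entire f -> fker f alpha ->
  fker (fadj f) beta -> pairing f alpha (iota c * beta) = c * pairing f alpha beta.
Proof.
move=> fE fa fb; have [g gE gt] := fdiv_ex fE fa.
apply: (pairing_uniq gE gt); rewrite (feval_iota complete_v) //.
apply: etrans (rmorphM iota _ _) _.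
exact: (congr1 ( *%R (iota c)) (pairing_val fE gE gt fb)).
Qed.

(** If [g] is the quotient for [h], associativity makes f o g the quotient for f o h, and adjunction
    moves [f] onto [beta]. *)
Lemma pairing_fcompr f h alpha beta : entire f -> entire h -> fker h alpha ->
  fker (fadj h) (feval (fadj f) beta) ->
  pairing (fcomp f h) alpha beta = pairing h alpha (feval (fadj f) beta).
Proof.
move=> fE hE ha hb; have [g gE gt] := fdiv_ex hE ha.
apply: (@pairing_uniq _ (fcomp f g)) => //.
  apply: etrans (fcompA complete_v iota fE hE (constE _)) _; rewrite gt.
  exact: esym (fcompA complete_v iota fE gE tmE).
rewrite (fadj_fcomp complete_v iota) // (feval_fcomp complete_v iota) //.
exact: pairing_val.
Qed.

(* [h o alpha - h(alpha)] kills [1], hence is divisible by [1 - tau]; the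
   adjoint of the extra factor is killed by [beta]. *)
Lemma pairing_fcompl f h alpha beta : entire f -> entire h ->
  fker (fcomp f h) alpha -> fker (fadj f) beta ->
  pairing (fcomp f h) alpha beta = pairing f (feval h alpha) beta.
Proof.
move=> fE hE fha fb.
have fa : fker f (feval h alpha).
  by rewrite fkerE -(feval_fcomp complete_v iota) // -fkerE.
have [g gE gt] := fdiv_ex fE fa.
have [k kE kt] : exists2 k, entire k &
    (fun n => fcomp h (fconst alpha) n - fconst (feval h alpha) n) = fcomp k tm.
  apply: one_sub_tau_div; first exact: entireB.
  rewrite (zsumB complete_v); try exact: (vanish_coef iota).
  rewrite (fcomp_constr complete_v iota) -fevalE.
  rewrite (zsum_fin complete_v (S := [:: 0])) ?big_seq1 ?subrr // => n.
  by rewrite inE /fconst => /negPf ->.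
apply: (@pairing_uniq _ (fun n => g n + fcomp f k n)); first exact: entireD.
  apply: etrans (fcompA complete_v iota fE hE (constE _)) _.
  apply: esym; apply: etrans (fcompDl complete_v iota gE (compE fE kE) tmE) _.
  rewrite -gt (fcompA complete_v iota fE kE tmE) -kt.
  rewrite -(fcompDr complete_v iota fE (constE _)); last exact: entireB.
  by congr fcomp; apply/funext => n; rewrite addrC subrK.
rewrite (fadjD iota) (fevalDl complete_v) //.
rewrite (fadj_fcomp complete_v iota) // (feval_fcomp complete_v iota) //.
have fb0 : feval (fadj f) beta = 0 by rewrite -fkerE.
rewrite fb0 (feval0 complete_v iota) addr0.
exact: pairing_val.
Qed.

(** Division of w o z by [1 - tau] with a constant remainder: subtracting w(z) makes the series
    vanish at 1. *)
Lemma one_sub_tau_rem (w : fseries) (z c : Cv) : entire w -> feval w z = c ->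
  exists2 k, entire k &
    forall n, k n - k (n - 1) = w n * qpow n z - fconst c n.
Proof.
move=> wE wz; have [||k kE kt] :=
  @one_sub_tau_div (fun n => fcomp w (fconst z) n - fconst c n).
- exact: entireB.
- rewrite (zsumB complete_v); try exact: (vanish_coef iota).
  rewrite (fcomp_constr complete_v iota) -fevalE wz.
  rewrite (zsum_fin complete_v (S := [:: 0])) ?big_seq1 ?subrr // => n.
  by rewrite inE /fconst => /negPf ->.
exists k => // n; have := congr1 (fun s : fseries => s n) kt.
by rewrite /= (fcomp_one_sub_tau complete_v iota) (fcomp_constr complete_v iota) => <-.
Qed.

(* Writing [beta o g = c + (1 - tau)^* o M] and [g'^* o alpha = c' + k o (1 - tau)]
   in [beta o g o (1 - tau) = beta o f o alpha = (1 - tau)^* o g'^* o alpha], the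
   factor [(1 - tau)^*] cancels and leaves [(M - k) o (1 - tau) = c' + c tau];
   evaluate at [1]. *)
Lemma fdiv_adj_anti f g g' alpha beta (c c' : Cv) :
  entire f -> entire g -> entire g' ->
  fcomp f (fconst alpha) = fcomp g tm ->
  fcomp (fadj f) (fconst beta) = fcomp g' tm ->
  feval (fadj g) beta = c -> feval (fadj g') alpha = c' ->
  (forall n, qpow n c = c) -> (forall n, qpow n c' = c') -> c' = - c.
Proof.
move=> fE gE gE' gt gt' gc gc' cfix c'fix.
have [m mE mP] := one_sub_tau_rem (adjE gE) gc.
have [k kE kP] := one_sub_tau_rem (adjE gE') gc'.
pose M := fadj m.
have ME : entire M by exact: entire_fadj.
have zconst (x : Cv) : zsum (fconst x) = x.
  rewrite (zsum_fin complete_v (S := [:: 0])) ?big_seq1 // => n.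
  by rewrite inE /fconst => /negPf ->.
have MP n : M n - qpow (-1) (M (n + 1)) = g n * beta - fconst c n.
  have := congr1 (qpow n) (mP (- n)).
  rewrite !(qpowB iota) (qpowM iota) /M /fadj opprK !(qpow_qpow iota).
  rewrite subrr !(qpow_id Fq) opprD.
  have -> : -1 + (n + 1) = n by ring.
  move=> ->; congr (_ - _); rewrite /fconst oppr_eq0.
  by case: ifP => _; rewrite ?cfix ?(qpow0 v iota).
have gP n : g n - g (n - 1) = f n * qpow n alpha.
  have := congr1 (fun s : fseries => s n) (esym gt).
  by rewrite /= (fcomp_one_sub_tau complete_v iota) (fcomp_constr complete_v iota).
pose G n := fadj g' n * qpow n alpha.
have GP n : G n - qpow (-1) (G (n + 1)) = f n * qpow n alpha * beta.
  have gn : g' (- n) - g' (- n - 1) = fadj f (- n) * qpow (- n) beta.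
    have := congr1 (fun s : fseries => s (- n)) (esym gt').
    by rewrite /= (fcomp_one_sub_tau complete_v iota) (fcomp_constr complete_v iota).
  have n1 : -1 + (n + 1) = n by ring.
  have -> : qpow (-1) (G (n + 1)) = qpow n (g' (- n - 1)) * qpow n alpha.
    by rewrite /G /fadj (qpowM iota) !(qpow_qpow iota) opprD n1.
  rewrite /G /fadj -mulrBl -(qpowB iota) gn (qpowM iota) /fadj.
  by rewrite !(qpow_qpow iota) opprK subrr !(qpow_id Fq) mulrAC.
(* [y] holds the coefficients of (M - k) o (1 - tau) - c' - c tau. It is shown to be killed by the
   adjoint of [1 - tau], hence to vanish. *)
pose D n := M n - k n; pose y n := D n - D (n - 1) - fconst c' n - fconst c (n - 1).
have DE : entire D by exact: entireB.
have yE : entire y.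
  apply: entireB; last first.
    apply: (@entire_fin _ _ _ _ _ [:: 1]) => n; rewrite inE /fconst => n1.
    by rewrite ifF //; lia.
  apply: entireB; last exact: entire_fconst.
  have := entire_fcomp complete_v iota DE tmE.
  by rewrite (fcomp_one_sub_tau complete_v iota).
have yS n : qpow (-1) (y (n + 1)) = y n.
  have cq (x : Cv) j : (forall i, qpow i x = x) -> qpow (-1) (fconst x j) = fconst x j.
    by move=> xf; rewrite /fconst; case: ifP => _; rewrite ?xf ?(qpow0 v iota).
  apply/eqP; rewrite eq_sym -subr_eq0 /y /D addrK.
  rewrite !(qpowB iota) !cq //.
  have k1 := kP n; have k2 := congr1 (qpow (-1)) (kP (n + 1)).
  have m1 := MP n; have m2 := MP (n - 1).
  rewrite -/(G n) in k1; rewrite -/(G (n + 1)) !(qpowB iota) addrK cq // in k2.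
  rewrite subrK in m2; have g1 := gP n; have G1 := GP n.
  have -> : M n - k n - (M (n - 1) - k (n - 1)) - fconst c' n - fconst c (n - 1) -
     (qpow (-1) (M (n + 1)) - qpow (-1) (k (n + 1)) - (qpow (-1) (M n) - qpow (-1) (k n)) -
      fconst c' (n + 1) - fconst c n) =
     (M n - qpow (-1) (M (n + 1))) - (M (n - 1) - qpow (-1) (M n)) -
     (k n - k (n - 1)) + (qpow (-1) (k (n + 1)) - qpow (-1) (k n)) -
     fconst c' n - fconst c (n - 1) + fconst c' (n + 1) + fconst c n by ring.
  rewrite m1 m2 k1 k2.
  have -> : g n = f n * qpow n alpha + g (n - 1) by rewrite -g1 subrK.
  have -> : G n = f n * qpow n alpha * beta + qpow (-1) (G (n + 1)).
    by rewrite -G1 subrK.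
  by apply/eqP; ring.
(* The relation [yS] says that the adjoint of [y] has constant coefficients; since they tend to 0,
   they vanish. *)
have y0 n : y n = 0.
  rewrite -[y](fadjK iota) [LHS]/(qpow n (fadj y (- n))).
  have -> : fadj y (- n) = 0; last exact: (qpow0 v iota).
  apply: (vanish_const (vanish_coef iota (adjE yE))) => j.
  rewrite /fadj -(yS (- (j + 1))) opprD subrK (qpow_qpow iota).
  by rewrite addrK.
have Dv := vanish_coef iota DE.
have D1v : vanish (fun n => D (n - 1)).
  by apply: (@vanish_can _ _ _ _ _ (fun n => n - 1) (+%R^~ 1)) Dv => n; rewrite subrK.
have : zsum y = 0.
  by rewrite (zsum_fin complete_v (S := [::])) ?big_nil.
have cv x : vanish (fconst x : fseries) by exact: (vanish_coef iota).
have c1v : vanish (fun n => fconst c (n - 1)).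
  by apply: (@vanish_can _ _ _ _ _ (fun n => n - 1) (+%R^~ 1)) (cv c) => n; rewrite subrK.
have w1v : vanish (fun n => D n - D (n - 1)) by exact/vanishD/vanishN.
have w2v : vanish (fun n => D n - D (n - 1) - fconst c' n).
  exact: (vanishD w1v (vanishN (cv c'))).
rewrite (zsumB complete_v w2v c1v) (zsumB complete_v w1v (cv c')).
rewrite (zsumB complete_v Dv D1v) (zsum_shift complete_v (-1) Dv).
rewrite (zsum_shift complete_v (-1) (cv c)) !zconst subrr sub0r => /eqP.
by rewrite subr_eq0 => /eqP <-; rewrite opprK.
Qed.

Lemma pairing_anti f alpha beta : entire f -> fker f alpha -> fker (fadj f) beta ->
  pairing (fadj f) beta alpha = - pairing f alpha beta.
Proof.
move=> fE fa fb; have faa : fker (fadj (fadj f)) alpha by rewrite (fadjK iota).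
have [g gE gt] := fdiv_ex fE fa; have [g' gE' gt'] := fdiv_ex (adjE fE) fb.
have p := pairing_val fE gE gt fb; have p' := pairing_val (adjE fE) gE' gt' faa.
apply: (fmorph_inj iota); apply: etrans (esym (rmorphN iota _)).
apply: (fdiv_adj_anti fE gE gE' gt gt' (esym p) (esym p')) => n;
exact: (qpow_iota v iota).
Qed.

Lemma pairingZl f c alpha beta : entire f -> fker f alpha ->
  fker (fadj f) beta -> pairing f (iota c * alpha) beta = c * pairing f alpha beta.
Proof.
move=> fE fa fb; have faa : fker (fadj (fadj f)) alpha by rewrite (fadjK iota).
apply: oppr_inj; apply: etrans (esym (pairing_anti fE (fkerZ c fE fa) fb)) _.
apply: etrans (pairingZr c (adjE fE) fb faa) _.
apply: etrans (congr1 ( *%R c) (pairing_anti fE fa fb)) _.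
exact: mulrN.
Qed.

(** * Orthogonality and nondegeneracy at given radii *)

Definition radii_meet f (r s : R) : Prop := exists n, 1 <= v (f n) * rq n r * s.

Lemma radii_meet_le f r r' s s' : 0 <= r -> 0 <= s -> r <= r' -> s <= s' ->
  radii_meet f r s -> radii_meet f r' s'.
Proof.
move=> r0 s0 rr ss [n fn]; exists n; apply: (le_trans fn).
rewrite ler_pM // ?mulr_ge0 ?absv_ge0 ?rq_ge0 //.
by rewrite ler_wpM2l ?absv_ge0 // rq_le.
Qed.

(** The power of exponent q^(-n) turns |f_n| r^(q^n) s into the corresponding product for the
    adjoint at index -n. *)
Lemma radii_meet_adj f r s : 0 <= r -> 0 <= s -> radii_meet f r s -> radii_meet (fadj f) s r.
Proof.
move=> r0 s0 [n fn]; exists (- n); rewrite absv_fadj opprK -rqM ?absv_ge0 //.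
have := rq_le Fq (- n) ler01 fn.
have fs0 : 0 <= v (f n) * s by rewrite mulr_ge0 ?absv_ge0.
by rewrite rq1 mulrAC (rqM Fq (- n) fs0 (rq_ge0 Fq n r)) (rqK Fq n r0).
Qed.

Lemma radii_meet_exists f k r : f k != 0 -> 0 < r -> exists2 s, 0 < s & radii_meet f r s.
Proof.
move=> fk r0; have fr : 0 < v (f k) * rq k r by rewrite mulr_gt0 ?absv_gt0 ?rq_gt0.
exists (v (f k) * rq k r)^-1; first by rewrite invr_gt0.
by exists k; rewrite divff // gt_eqF.
Qed.

Lemma not_radii_meet_exists f r : entire f -> 0 <= r ->
  exists2 s, 0 < s & ~ radii_meet f r s.
Proof.
move=> fE r0; have [M M0 fM] := entire_bounded r0 fE.
exists (M + 1)^-1; first by rewrite invr_gt0 addr_gt0.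
move=> [n]; rewrite leNgt => /negP; apply.
by rewrite ltr_pdivrMr ?addr_gt0 // mul1r (le_lt_trans (fM n)) // ltrDl.
Qed.

(** From c^q = c the absolute value satisfies t^q = t, so it is 0 or 1. *)
Lemma absv_iota_lt1 c : v (iota c) < 1 -> c = 0.
Proof.
move=> vc; apply/eqP/negPn/negP => c0.
have v0 : 0 < v (iota c) by rewrite absv_gt0 fmorph_eq0.
have : v (iota c) ^+ q = v (iota c) by rewrite -absvX -rmorphXn expf_card.
have /prednK <- := card_Fq_gt0 Fq; rewrite exprS => /eqP.
rewrite -subr_eq0 -[X in _ - X]mulr1 -mulrBr mulf_eq0 gt_eqF //= subr_eq0.
by rewrite lt_eqF // exprn_ilt1 ?absv_ge0 // -lt0n -ltnS prednK ?card_Fq_gt1 ?card_Fq_gt0.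
Qed.

(** Unlike [fdiv_ex], this exhibits the quotient as partial sums, whose sizes can be estimated. *)
Lemma fquo_fker f alpha : entire f -> fker f alpha ->
  let u := fcomp f (fconst alpha) in entire (fquo u) /\ u = fcomp (fquo u) tm.
Proof.
move=> fE fa /=; have uE : entire (fcomp f (fconst alpha)) by [].
split; last by rewrite (fquoK complete_v iota (vanish_coef iota uE)).
apply: (entire_fquo complete_v iota uE).
by rewrite (fcomp_constr complete_v iota) -fevalE -fkerE.
Qed.

(** The coefficients of the quotient are partial sums of terms of size < 1/|beta|. Each term of the
    adjoint at [beta] is thus a power of a number < 1, and so the value in [Fq] has size < 1. *)
Lemma pairing_orth f alpha beta : entire f -> fker f alpha -> fker (fadj f) beta ->
  ~ radii_meet f (v alpha) (v beta) -> pairing f alpha beta = 0.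
Proof.
move=> fE fa fb nm; apply: absv_iota_lt1.
have [gE gt] := fquo_fker fE fa; rewrite (pairing_val fE gE gt fb).
have uv : vanish (fcomp f (fconst alpha)) by exact: (vanish_coef iota).
have [b0|b0] := eqVneq (v beta) 0.
  by move/absv_eq0: b0 => ->; rewrite (feval0 complete_v iota) absv0.
have {}b0 : 0 < v beta by rewrite lt_def b0 absv_ge0.
apply: feval_lt => // n; rewrite absv_fadj -rqM ?absv_ge0 //.
rewrite -(rq1 _ Fq n) rq_lt ?mulr_ge0 ?absv_ge0 // -ltr_pdivlMr // mul1r.
apply: zsum_lt => //; first exact: vanish_if.
  by rewrite invr_gt0.
move=> i; case: ifP => _; last by rewrite absv0 invr_gt0.
rewrite (fcomp_constr complete_v iota) absvM absv_qpow -[ltRHS]mul1r.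
by rewrite ltr_pdivlMr // ltNge; apply/negP => mi; apply: nm; exists i.
Qed.

(** The leftmost maximum is chosen so that, in the partial sum up to [m], the last term strictly
    dominates all others. *)
Lemma vanish_max (u : int -> Cv) k : vanish u -> u k != 0 ->
  exists2 m, (forall n, v (u n) <= v (u m)) &
    forall n, n < m -> v (u n) < v (u m).
Proof.
rewrite -(absv_gt0 v) => u0 uk; have [S Su] := u0 _ uk.
have [m [mS mP]] : exists m, m \in k :: S /\ forall n, n \in k :: S ->
    v (u n) < v (u m) \/ (v (u n) = v (u m) /\ m <= n).
  elim: (S) => [|j T [m [mT mP]]].
    by exists k; split=> [|n]; rewrite ?mem_head // inE => /eqP ->; right.
  have [jm|jm] := pselect (v (u j) < v (u m) \/ (v (u j) = v (u m) /\ m <= j)).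
    exists m; split=> [|n].
      by move: mT; rewrite !inE => /orP[->|->] //; rewrite !orbT.
    rewrite !inE => /or3P[nk|/eqP -> //|nT]; apply: mP; rewrite inE ?nk //.
    by rewrite nT orbT.
  exists j; split=> [|n]; first by rewrite !inE eqxx orbT.
  have {}jm : v (u m) < v (u j) \/ (v (u m) = v (u j) /\ j <= m).
    have [mj|mj|mj] := ltgtP (v (u m)) (v (u j)); [by left| |].
      by case: jm; left.
    right; split=> //; have [//|mj'] := leP j m.
    by case: jm; right; split; [rewrite mj|exact: ltW].
  have nm : n \in k :: T -> v (u n) < v (u j) \/ (v (u n) = v (u j) /\ j <= n).
    move=> /mP[nm|[nm mn]].
      by left; case: jm => [|[<- _] //]; exact: lt_trans.
    case: jm => [mj|[mj jm]]; [left; by rewrite nm|right].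
    by split; [rewrite nm|exact: le_trans mn].
  rewrite !inE => /or3P[nk|/eqP ->|nT]; [|by right|];
    by apply: nm; rewrite inE ?nk ?nT ?orbT.
have uk_m : v (u k) <= v (u m).
  by have [/ltW|[-> _]] := mP k (mem_head _ _).
exists m => n => [|nm]; have [nS|nS] := boolP (n \in k :: S).
- by have [/ltW|[-> _]] := mP n nS.
- apply: (le_trans _ uk_m); apply/ltW/Su; apply: contra nS => nS.
  by rewrite inE nS orbT.
- by have [//|[_ mn]] := mP n nS; move: nm; rewrite ltNge mn.
- apply: lt_le_trans uk_m; apply: Su; apply: contra nS => nS.
  by rewrite inE nS orbT.
Qed.

(* [beta] is a solution of [g^*(beta) = 1]: then [alpha f^*(beta) = 0] by
   [fdiv_adjoint]. The coefficient of [g] at the least index where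
   [|f_n alpha^(q^n)|] is maximal has that absolute value. *)
Lemma pairing_nondeg f alpha s : entire f -> fker f alpha -> 0 <= s ->
  radii_meet f (v alpha) s ->
  exists beta, [/\ fker (fadj f) beta, v beta <= s & pairing f alpha beta != 0].
Proof.
move=> fE fa s0 [k fk]; have [gE gt] := fquo_fker fE fa.
set u := fcomp f (fconst alpha) in gE gt.
have uv : vanish u := vanish_coef iota (compE fE (constE alpha)).
have vu n : v (u n) = v (f n) * rq n (v alpha).
  by rewrite /u (fcomp_constr complete_v iota) absvM absv_qpow.
have uk : u k != 0.
  apply: contraTneq fk => uk; rewrite -vu uk absv0 mul0r.
  by rewrite ler10.
have [m um um'] := vanish_max uv uk.
have um0 : 0 < v (u m) by rewrite (lt_le_trans _ (um k)) // absv_gt0.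
have gm : v (fquo u m) = v (u m).
  rewrite -[fquo u m](subrK (u m)) addrC absvDr_eq //.
  have := @zsum_approx _ _ _ complete_v (fun i => if i <= m then u i else 0) [:: m]
    _ (vanish_if _ uv) um0 isT.
  rewrite big_seq1 lexx; apply=> n; rewrite inE => nm.
  case: ifP => nm'; last by rewrite absv0.
  by apply: um'; rewrite lt_neqAle nm.
have [|beta bs gb] := @entire_solve _ _ _ _ complete_v iota (fadj (fquo u)) (- m) 1 s
   (adjE gE) s0.
  rewrite absv1 absv_fadj opprK -rqM ?absv_ge0 // -(rq1 _ Fq (- m)) rq_le // gm.
  by rewrite (le_trans fk) // -vu ler_wpM2r.
have fb : fker (fadj f) beta.
  have /eqP := fdiv_adjoint beta fE gE gt.
  rewrite gb (qpow1 v iota) subrr eq_sym mulf_eq0 fkerE => /orP[/eqP a0|/eqP //].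
  move: uk; rewrite /u (fcomp_constr complete_v iota) a0.
  by rewrite (qpow0 v iota) mulr0 eqxx.
exists beta; split => //.
by rewrite (pairing_uniq (c := 1) gE gt) ?oner_eq0 // rmorph1 gb.
Qed.

End Pairing.

(** * Duality of locally compact subspaces *)

(** [B] is spanned by the finitely many members of [U], and the columns of [cokermx B] are
    functionals killing [U]; a vector killed by them lies in the row space of [B]. *)
Lemma subspace_separation (F : finFieldType) (n : nat) (U : set 'rV[F]_n)
    (x : 'rV[F]_n) :
  U 0 -> (forall u w, U u -> U w -> U (u + w)) ->
  (forall c u, U u -> U (c *: u)) ->
  (forall c : 'cV[F]_n, (forall u, U u -> u *m c = 0) -> x *m c = 0) -> U x.
Proof.
move=> U0 UD UZ sep; pose B := (\sum_(u : 'rV[F]_n | `[< U u >]) <<u>>)%MS.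
have BU u : U u -> u *m cokermx B = 0.
  move=> Uu; apply/eqP; rewrite -submxE.
  apply: (submx_trans _ (sumsmx_sup u _ (submx_refl _))); last exact/asboolP.
  by rewrite genmxE.
have /sub_sumsmxP[w ->] : (x <= B)%MS.
  rewrite submxE; apply/eqP/matrixP => i j.
  have : x *m col j (cokermx B) = 0.
    by apply: sep => u /BU uB; rewrite colE mulmxA uB mul0mx.
  by rewrite colE mulmxA -colE => /matrixP/(_ i 0); rewrite [LHS]mxE !mxE.
apply: big_ind => // u /asboolP Uu.
have /sub_rVP[c ->] : (w u *m <<u>> <= u)%MS.
  by rewrite (submx_trans (submxMl _ _)) // genmxE.
exact: UZ.
Qed.

Section Duality.
Variables (R : realType) (Fq : finFieldType) (C : closedFieldType).
Variable v : nonarch_absval R C.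
Hypothesis complete_v : absv_complete v.
Variable iota : {rmorphism Fq -> C}.
Local Notation Cv := (valued v).

(** Compactness of balls, split into closedness and total boundedness. The net is not asked to lie
    in [V]: for kernels it consists of zeros of a truncation. *)
Record lc_subspace (V : set Cv) : Prop := {
  lc_0 : V 0;
  lc_D : forall x y, V x -> V y -> V (x + y);
  lc_Z : forall c x, V x -> V (iota c * x);
  lc_closed : forall x, (forall e : R, 0 < e -> exists2 y, V y & v (x - y) < e) -> V x;
  lc_precompact : forall r d : R, 0 <= r -> 0 < d -> exists s : seq C,
    forall z, V z -> v z <= r -> exists2 x, x \in s & v (z - x) < d }.

(** [meet r s] expresses that the balls of radii [r] in [V] and [s] in [W] pair
    nontrivially; for kernels it is [radii_meet f r s]. *)
Record duality (V W : set Cv) (b : Cv -> Cv -> Fq) (meet : R -> R -> Prop) :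
    Prop := {
  du_V : lc_subspace V;
  du_W : lc_subspace W;
  du_Dl : forall x1 x2 y, V x1 -> V x2 -> W y -> b (x1 + x2) y = b x1 y + b x2 y;
  du_Dr : forall x y1 y2, V x -> W y1 -> W y2 -> b x (y1 + y2) = b x y1 + b x y2;
  du_Zl : forall c x y, V x -> W y -> b (iota c * x) y = c * b x y;
  du_Zr : forall c x y, V x -> W y -> b x (iota c * y) = c * b x y;
  du_le : forall r r' s s', 0 <= r -> 0 <= s -> r <= r' -> s <= s' ->
    meet r s -> meet r' s';
  du_orth : forall x y, V x -> W y -> ~ meet (v x) (v y) -> b x y = 0;
  du_ndl : forall x s, V x -> 0 <= s -> meet (v x) s ->
    exists y, [/\ W y, v y <= s & b x y != 0];
  du_ndr : forall y r, W y -> 0 <= r -> meet r (v y) ->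
    exists x, [/\ V x, v x <= r & b x y != 0];
  du_meetr : forall r, 0 < r -> exists2 s, 0 < s & meet r s;
  du_meetl : forall s, 0 < s -> exists2 r, 0 < r & meet r s;
  du_nmeetr : forall r, 0 <= r -> exists2 s, 0 < s & ~ meet r s;
  du_nmeetl : forall s, 0 <= s -> exists2 r, 0 < r & ~ meet r s }.

Lemma duality_sym V W b meet : duality V W b meet ->
  duality W V (fun y x => b x y) (fun s r => meet r s).
Proof.
case=> ? ? Dl Dr Zl Zr le orth ? ? ? ? ? ?; split=> //.
- by move=> x1 x2 y ? ? ?; exact: Dr.
- by move=> x y1 y2 ? ? ?; exact: Dl.
- by move=> c x y ? ?; exact: Zr.
- by move=> c x y ? ?; exact: Zl.
- by move=> r r' s s' ? ? ? ?; exact: le.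
- by move=> x y ? ?; exact: orth.
Qed.

Lemma iotaN1 (x : Cv) : iota (-1) * x = - x.
Proof. by rewrite rmorphN1 mulN1r. Qed.

Lemma lc_B V x y : lc_subspace V -> V x -> V y -> V (x - y).
Proof.
by move=> VS Vx Vy; rewrite -iotaN1; apply: lc_D => //; exact: lc_Z.
Qed.

Lemma absv_iota_le1 c : v (iota c) <= 1.
Proof.
rewrite leNgt; apply/negP => c1.
have c0 : 0 < v (iota c) := lt_trans ltr01 c1.
have : v (iota c) ^+ #|Fq| = v (iota c) by rewrite -absvX -rmorphXn expf_card.
apply/eqP; rewrite gt_eqF //; have /prednK <- := card_Fq_gt0 Fq.
rewrite exprS ltr_pMr // exprn_egt1 // -lt0n.
by rewrite -ltnS prednK ?card_Fq_gt1 ?card_Fq_gt0.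
Qed.

Section OneSide.
Variables (V W : set Cv) (b : Cv -> Cv -> Fq) (meet : R -> R -> Prop).
Hypothesis du : duality V W b meet.

Lemma du_Bl x1 x2 y : V x1 -> V x2 -> W y -> b (x1 - x2) y = b x1 y - b x2 y.
Proof.
move=> V1 V2 Wy; rewrite -iotaN1 (du_Dl du) // ?(du_Zl du) ?mulN1r //.
exact: lc_Z (du_V du) _ _ _.
Qed.

Lemma du_not_meet x s : V x -> 0 <= s ->
  (forall y, W y -> v y <= s -> b x y = 0) -> ~ meet (v x) s.
Proof.
move=> Vx s0 x0 /(du_ndl du Vx s0)[y [Wy ys]].
by rewrite x0 // eqxx.
Qed.

Lemma du_inj x x' : V x -> V x' -> (forall y, W y -> b x y = b x' y) -> x = x'.
Proof.
move=> Vx Vx' xx'; apply/eqP; rewrite -subr_eq0 -[_ == 0]negbK.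
rewrite -(absv_gt0 v); apply/negP => d0.
have [s s0 m] := du_meetr du d0.
apply: (du_not_meet (lc_B (du_V du) Vx Vx') (ltW s0) _ m) => y Wy _.
by rewrite du_Bl // xx' // subrr.
Qed.

Section Functional.
Variable chi : Cv -> Fq.
Hypothesis chiD : forall y1 y2, W y1 -> W y2 -> chi (y1 + y2) = chi y1 + chi y2.
Hypothesis chiZ : forall c y, W y -> chi (iota c * y) = c * chi y.

(** Up to differences below [d] the ball of radius [S] in [W] is finite, and on representatives the
    claim is linear algebra. Such differences do not matter: they are killed by [chi] (bound [s0])
    and by the ball of radius [r] in [V] (bound [s1]). *)
Lemma du_represent_ball (r s0 S : R) : 0 < r -> 0 < s0 -> 0 <= S ->
  meet r s0 -> (forall y, W y -> v y < s0 -> chi y = 0) ->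
  exists x, [/\ V x, v x <= r & forall y, W y -> v y <= S -> b x y = chi y].
Proof.
move=> r0 s00 S0 m chi0; have [VS WS] := (du_V du, du_W du).
have [s1 s10 nm] := du_nmeetr du (ltW r0).
pose d := Num.min s0 s1; have d0 : 0 < d by rewrite lt_min s00.
have [t tP] := lc_precompact WS S0 d0.
(* Net points need not lie in [W]: each is replaced by an element of the ball near it, or by 0 if
   there is none. *)
have /choice[rep repP] (z : Cv) : exists w : Cv, (W w /\ v w <= S) /\
    ((exists y, [/\ W y, v y <= S & v (y - z) < d]) -> v (w - z) < d).
  have [[y [Wy yS yz]]|no] := pselect (exists y, [/\ W y, v y <= S & v (y - z) < d]).
    by exists y.
  by exists 0; split=> //; split; [exact: lc_0|rewrite absv0].
pose n := size t; pose be (i : 'I_n) : Cv := rep (nth 0 t i).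
have beW i : W (be i) by have [[]] := repP (nth 0 t i).
have beS i : v (be i) <= S by have [[]] := repP (nth 0 t i).
pose U := [set u : 'rV[Fq]_n | exists x, [/\ V x, v x <= r & u = \row_i b x (be i)]].
have comb (c : 'cV[Fq]_n) (f : Cv -> Fq) :
    (forall y1 y2, W y1 -> W y2 -> f (y1 + y2) = f y1 + f y2) ->
    (forall c y, W y -> f (iota c * y) = c * f y) ->
    let y := \sum_i iota (c i 0) * be i in
    [/\ W y, v y <= S & f y = \sum_i f (be i) * c i 0].
  move=> fD fZ /=; apply: (big_ind2 (fun y t => [/\ W y, v y <= S & f y = t])).
  - split; [exact: lc_0|by rewrite absv0|].
    by have := fZ 0 0 (lc_0 WS); rewrite rmorph0 !mul0r.
  - move=> y1 t1 y2 t2 [W1 S1 <-] [W2 S2 <-].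
    by split; [exact: lc_D|exact: absvD_le|exact: fD].
  - move=> i _; split; [exact: lc_Z| |by rewrite fZ // mulrC].
    by rewrite absvM (le_trans _ (beS i)) // ler_piMl ?absv_ge0 // absv_iota_le1.
have : U (\row_i chi (be i)).
  apply: subspace_separation.
  - exists 0; split; [exact: lc_0|by rewrite absv0 ltW|].
    apply/rowP => i; rewrite !mxE.
    by have := du_Zl du 0 (lc_0 VS) (beW i); rewrite rmorph0 !mul0r.
  - move=> _ _ [x1 [V1 r1 ->]] [x2 [V2 r2 ->]]; exists (x1 + x2).
    split; [exact: lc_D|exact: absvD_le|].
    by apply/rowP => i; rewrite !mxE (du_Dl du).
  - move=> c _ [x [Vx rx ->]]; exists (iota c * x); split; [exact: lc_Z| |].
      by rewrite absvM (le_trans _ rx) // ler_piMl ?absv_ge0 // absv_iota_le1.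
    by apply/rowP => i; rewrite !mxE (du_Zl du).
  - move=> c Uc; have [Wy _ chiy] := comb c chi chiD chiZ.
    set y := \sum_i _ in Wy chiy.
    (* By linearity the whole ball of radius [r] pairs to zero with [y]; if [r] and [v y] met, some
       member would detect [y]. Since [r] and [s0] meet, this forces [v y < s0], where [chi]
       vanishes. *)
    have nmy : ~ meet r (v y).
      move=> /(du_ndr du Wy (ltW r0))[x [Vx xr]]; apply/negP; rewrite negbK.
      have [_ _ ->] := comb c (b x) (fun y1 y2 => du_Dr du Vx (y1 := y1) (y2 := y2))
        (fun c y => du_Zr du c Vx (y := y)).
      have /matrixP/(_ 0 0) : (\row_i b x (be i)) *m c = 0 by apply: Uc; exists x.
      rewrite [RHS]mxE mxE => bc; apply/eqP; rewrite -[RHS]bc.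
      by apply: eq_bigr => i _; rewrite mxE.
    have ys0 : v y < s0.
      rewrite ltNge; apply/negP => sy; apply: nmy.
      exact: (du_le du (ltW r0) (ltW s00) (lexx r) sy m).
    apply/matrixP => i j; rewrite !ord1 [RHS]mxE mxE -[RHS](chi0 y Wy ys0) chiy.
    by apply: eq_bigr => k _; rewrite mxE.
move=> [x [Vx xr xchi]]; exists x; split=> // y Wy yS.
have [z zt yz] := tP y Wy yS.
have [[Wz zS] /(_ _) zP] := repP z.
have yzd : v (y - rep z) < d.
  rewrite -[y](subrK z) -addrA; apply: absvD_lt => //.
  by rewrite -opprB absvN; apply: zP; exists y.
have bz : b x (rep z) = chi (rep z).
  have zn : (index z t < n)%N by rewrite index_mem.
  move/rowP/(_ (Ordinal zn)): xchi.
  by rewrite !mxE /be /= nth_index.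
have Wyz := lc_B WS Wy Wz.
rewrite -[y](subrK (rep z)) (du_Dr du) // chiD // bz; congr (_ + _).
rewrite chi0 //; last by rewrite (lt_le_trans yzd) // ge_min lexx.
apply: (du_orth du) => // mm; apply: nm.
apply: (du_le du (absv_ge0 _ _) (absv_ge0 _ _) xr _ mm).
by rewrite ltW // (lt_le_trans yzd) // ge_min lexx orbT.
Qed.

(** Let [a n] represent [chi] on the ball of radius [n]. Then [a n.+1 - a n] annihilates that ball,
    and nondegeneracy makes it tend to 0. The limit differs from [a n] by a vector that, for large
    [n], is orthogonal to any given [y]. *)
Lemma du_represent (s0 : R) : 0 < s0 ->
  (forall y, W y -> v y < s0 -> chi y = 0) ->
  exists2 x, V x & forall y, W y -> b x y = chi y.
Proof.
move=> s00 chi0; have [VS WS] := (du_V du, du_W du).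
have [r r0 m] := du_meetl du s00.
have /choice[a aP] (n : nat) : exists x : Cv, V x /\
    forall y, W y -> v y <= n%:R -> b x y = chi y.
  by have [x [Vx _ xP]] := du_represent_ball r0 s00 (ler0n R n) m chi0; exists x.
have aV n : V (a n) by have [] := aP n.
have {}aP n y : W y -> v y <= n%:R -> b (a n) y = chi y by have [_] := aP n; exact.
have natge (x : R) : exists N : nat, forall n, (N <= n)%N -> x <= n%:R.
  exists (Num.bound `|x|) => n Nn; rewrite (le_trans (ler_norm x)) //.
  by rewrite (le_trans (ltW (archi_boundP (normr_ge0 x)))) // ler_nat.
have [|L LP] := @seq_limit _ _ _ complete_v (fun n => a n.+1 - a n).
  move=> e e0; have [S S0 mS] := du_meetr du e0; have [N NP] := natge S.
  exists N => n Nn; rewrite ltNge; apply/negP => en.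
  apply: (@du_not_meet (a n.+1 - a n) n%:R); [exact: lc_B|exact: ler0n| |].
    move=> y Wy yn; rewrite du_Bl // !aP ?subrr //.
    by rewrite (le_trans yn) // ler_nat.
  exact: (du_le du (ltW e0) (ltW S0) en (NP n Nn) mS).
have sumE n : \sum_(i < n) (a i.+1 - a i) = a n - a 0%N.
  by rewrite -(big_mkord xpredT (fun i => a i.+1 - a i)) telescope_sumr.
pose x := L + a 0%N.
have xP e : 0 < e -> exists N : nat, forall n, (N <= n)%N -> v (x - a n) < e.
  move=> /LP[N NP]; exists N => n /NP; rewrite sumE.
  by congr (v _ < _); rewrite /x; ring.
have Vx : V x.
  apply: (lc_closed VS) => e /xP[N /(_ N (leqnn N)) xN]; exists (a N) => //.
exists x => // y Wy; have [d d0 nm] := du_nmeetl du (absv_ge0 v y).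
have [N NP] := xP d d0; have [M MP] := natge (v y).
pose n := maxn N M; have xn := NP n (leq_maxl _ _); have yn := MP n (leq_maxr _ _).
rewrite -[x](subrK (a n)) (du_Dl du) //; last exact: lc_B.
rewrite aP // (du_orth du) ?add0r //; first exact: lc_B.
move=> mm; apply: nm.
exact: (du_le du (absv_ge0 _ _) (absv_ge0 _ _) (ltW xn) (lexx _) mm).
Qed.

End Functional.
End OneSide.
End Duality.

(** * Topological duality *)

Lemma cvg_set_type (X : topologicalType) (A : set X) (T : Type)
    (F : set_system T) (g : T -> A) (l : A) : Filter F ->
  (\val \o g) @ F --> (\val l : X) -> g @ F --> l.
Proof.
move=> FF gl U [_ [[N oN <-] Nl NU]].
have /gl : nbhs (\val l : X) N by exact: open_nbhs_nbhs.
by rewrite /nbhs /=; apply: filterS => t; exact: NU.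
Qed.

(** [A] and [Fq] are discrete, so convergence is eventual equality at each point; the near-covering
    form of compactness makes it uniform on a compact [K]. *)
Lemma cvg_dual (Fq : finFieldType) (A : comNzRingType) (constA : Fq -> A)
    (T : Type) (F : set_system T) (g : T -> dual constA) (l : dual constA) :
  Filter F -> (forall a, \forall t \near F, g t a = l a) -> g @ F --> l.
Proof.
move=> FF gl; apply: cvg_set_type; apply/compact_open_cvgP => K N cK oN lN.
have : \forall t \near F, forall a, K a -> g t a = l a.
  apply: ((compact_near_coveringP K).1 cK T F (fun t a => g t a = l a)) => a Ka.
  exists ([set a], [set t | g t a = l a]); last by move=> [_ t] /= [-> ].
  by split; [exact: discrete_set1|exact: gl].
apply: filterS => t gt _ [a Ka <-]; apply: lN; exists a => //.
exact: esym (gt a Ka).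
Qed.

Lemma dual_eval_open (Fq : finFieldType) (A : comNzRingType) (constA : Fq -> A)
    (a : A) (c : Fq) : open [set chi : dual constA | chi a = c].
Proof.
exists [set h : {compact-open, discrete_topology A -> discrete_topology Fq} |
  h @` [set a] `<=` [set c]].
  by apply: compact_open_open; [exact: compact_set1|exact: discrete_open].
apply/seteqP; split=> chi /= => [ac|<- _ [_ -> <-] //].
by apply: ac; exists a.
Qed.

Lemma ultra_finite_union (T : Type) (I : eqType) (F : set_system T) (s : seq I)
    (Q : I -> set T) : UltraFilter F ->
  F [set y | exists2 i, i \in s & Q i y] -> exists2 i, i \in s & F (Q i).
Proof.
move=> FU; elim: s => [|i s IH] Fs.
  by have [y []] := filter_ex Fs.
have [Fi|Fi] := in_ultra_setVsetC (Q i) FU; first by exists i; rewrite ?mem_head.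
have [|j js Fj] := IH; last by exists j; rewrite // inE js orbT.
apply: filterS (filterI Fs Fi) => y [ [j + Qj] nQi].
by rewrite inE => /predU1P[ji|js]; [case: nQi; rewrite -ji|exists j].
Qed.

Section SubspaceTopology.
Variables (R : realType) (Fq : finFieldType) (C : closedFieldType).
Variable v : nonarch_absval R C.
Hypothesis complete_v : absv_complete v.
Variable iota : {rmorphism Fq -> C}.
Local Notation Cv := (valued v).

Lemma nbhs_subP (V : set Cv) (x : V) (U : set V) :
  nbhs x U <-> exists2 e : R, 0 < e & forall y : V, v (\val x - \val y) < e -> U y.
Proof.
split=> [/nbhs_ballP[e e0 eU]|[e e0 eU]].
  by exists e => // y; exact: eU.
by apply/nbhs_ballP; exists e => //.
Qed.

(** An ultrafilter on the ball contains a member of each finite cover by small balls, so it is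
    Cauchy; completeness gives a limit and closedness puts it in [V]. *)
Lemma lc_ball_compact (V : set Cv) r : lc_subspace iota V -> 0 <= r ->
  compact [set x : V | v (\val x) <= r].
Proof.
move=> VS r0; rewrite compact_ultra => F FU FK.
pose G := (\val : V -> Cv) @ F.
have near_pt e : 0 < e -> exists z : Cv, F [set y : V | v (\val y - z) < e].
  move=> e0; have [s sP] := lc_precompact VS r0 e0.
  have [|z _ Fz] := @ultra_finite_union _ _ F s (fun z y => v (\val y - z) < e).
    by apply: filterS FK => y yr; exact: sP (set_valP y) yr.
  by exists z.
have /complete_v : cauchy G.
  apply: cauchy_exP => e e0; have [z Fz] := near_pt e e0; exists z.
  change (F [set y : V | v (z - \val y) < e]).
  by apply: filterS Fz => y /=; rewrite -absvN opprB.
set p := lim G => Gp.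
have pF e : 0 < e -> F [set y : V | v (p - \val y) < e].
  by move=> e0; have /fcvg_ballP/(_ e e0) := Gp.
have pK e : 0 < e -> exists2 y : V, v (\val y) <= r & v (p - \val y) < e.
  by move=> /pF Fp; have [y [yr yp]] := filter_ex (filterI FK Fp); exists y.
have Vp : V p.
  by apply: (lc_closed VS) => e /pK[y _ yp]; exists (\val y) => //; exact: set_valP.
exists (SigSub (mem_set Vp)); split => /=.
  (* A point closer to [p] than [v p] has the same absolute value as [p], so [v p > r] is
     impossible. *)
  rewrite leNgt; apply/negP => rp; have [y yr yp] := pK (v p) (le_lt_trans r0 rp).
  have : v (\val y) = v p by rewrite -(subKr p (\val y)) absvDr_eq ?absvN.
  by move=> yp'; move: yr; rewrite yp' leNgt rp.
by apply: (@cvg_set_type _ V V F id).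
Qed.

End SubspaceTopology.

(** * From orthogonality of balls to duality of topological [A]-modules *)

Section TopologicalDuality.
Variables (R : realType) (Fq : finFieldType) (C : closedFieldType).
Variable v : nonarch_absval R C.
Hypothesis complete_v : absv_complete v.
Variable iota : {rmorphism Fq -> C}.
Local Notation Cv := (valued v).
Variables (A : comNzRingType) (constA : Fq -> A).

Record module_duality (V W : set Cv) (b : Cv -> Cv -> Fq) (meet : R -> R -> Prop)
    (act act' : A -> Cv -> Cv) : Prop := {
  md_du : duality iota V W b meet;
  md_V : Amodule V act;
  md_W : Amodule W act';
  md_constV : forall c x, V x -> act (constA c) x = iota c * x;
  md_constW : forall c y, W y -> act' (constA c) y = iota c * y;
  md_adj : forall a x y, V x -> W y -> b (act a x) y = b x (act' a y);
  md_contV : forall a e, 0 < e ->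
    exists2 d, 0 < d & forall x, V x -> v x < d -> v (act a x) < e;
  md_contW : forall a e, 0 < e ->
    exists2 d, 0 < d & forall y, W y -> v y < d -> v (act' a y) < e }.

Lemma module_duality_sym V W b meet act act' :
  module_duality V W b meet act act' ->
  module_duality W V (fun y x => b x y) (fun s r => meet r s) act' act.
Proof.
case=> du VM WM cV cW adj contV contW; split=> //; first exact: duality_sym.
by move=> a y x Wy Vx; rewrite adj.
Qed.

Variables (V W : set Cv) (b : Cv -> Cv -> Fq) (meet : R -> R -> Prop).
Variables act act' : A -> Cv -> Cv.
Hypothesis md : module_duality V W b meet act act'.

Let du := md_du md.
Let VM := md_V md.
Let WM := md_W md.

Lemma bracket_dual (x y : Cv) : V x -> W y ->
  dual_set constA (fun a => b (act a x) y).
Proof.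
move=> Vx Wy; split=> [a a'|c a].
  by rewrite (am_actDl VM) // (du_Dl du) //; exact: (am_act VM).
have Vax := am_act VM a Vx.
by rewrite (am_actM VM) // (md_constV md) // (du_Zl du).
Qed.

Lemma module_duality_Apairing :
  Apairing V W act act' (fun x y a => b (act a x) y).
Proof.
split=> [x1 x2 y V1 V2 Wy|x y1 y2 Vx W1 W2|a x y Vx Wy].
- apply/funext => a; rewrite /= (am_actDr VM) // (du_Dl du) //; exact: (am_act VM).
- apply/funext => a; rewrite /= (du_Dr du) //; exact: (am_act VM).
have E a' : b (act a' x) (act' a y) = b (act (a * a') x) y.
  by rewrite -(md_adj md) ?(am_actM VM) //; exact: (am_act VM).
split; apply/funext => a' //.
by rewrite E mulrC (am_actM VM).
Qed.

Definition dbracket (x : V) (y : W) : dual constA :=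
  SigSub (mem_set (bracket_dual (set_valP x) (set_valP y))).

Lemma dbracketE x y a : dbracket x y a = b (act a (\val x)) (\val y).
Proof. by []. Qed.

(** At each [a] the bracket is locally constant. Moving [x] changes it by a pairing of a vector
    smaller than [r] with one of size at most max(|y0|, 1); moving [y] changes it by a pairing of
    [act a x0] with a vector smaller than [s]. Both vanish by orthogonality. *)
Lemma dbracket_continuous : continuous (fun p : V * W => dbracket p.1 p.2).
Proof.
move=> [x0 y0]; apply: cvg_dual => a.
have [Vx0 Wy0] := (set_valP x0, set_valP y0).
have M0 : 0 <= Num.max (v (\val y0)) 1 by rewrite le_max ler01 orbT.
have [r r0 nr] := du_nmeetl du M0.
have [s s0 ns] := du_nmeetr du (absv_ge0 v (act a (\val x0))).
have [d d0 dP] := md_contV md a r0.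
exists ([set x : V | v (\val x0 - \val x) < d],
        [set y : W | v (\val y0 - \val y) < Num.min s 1]).
  split; apply/nbhs_subP; first by exists d.
  by exists (Num.min s 1) => //; rewrite lt_min s0 ltr01.
move=> [x y] /= [xd]; rewrite lt_min => /andP[ys y1].
have [Vx Wy] := (set_valP x, set_valP y); rewrite !dbracketE.
have Vd : V (\val x - \val x0) := lc_B (du_V du) Vx Vx0.
have Wd : W (\val y - \val y0) := lc_B (du_W du) Wy Wy0.
have -> : act a (\val x) = act a (\val x - \val x0) + act a (\val x0).
  by rewrite -(am_actDr VM) // subrK.
have [Vad Vax0] := (am_act VM a Vd, am_act VM a Vx0).
have bad : b (act a (\val x - \val x0)) (\val y) = 0.
  apply: (du_orth du) => // mm; apply: nr.
  have xr : v (act a (\val x - \val x0)) < r by apply: dP; rewrite // -absvN opprB.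
  apply: (du_le du (absv_ge0 _ _) (absv_ge0 _ _) (ltW xr) _ mm).
  rewrite -[\val y](subKr (\val y0)); apply: absvB_le; rewrite le_max ?lexx //.
  by rewrite (ltW y1) orbT.
rewrite (du_Dl du) // bad add0r -[\val y](subrK (\val y0)) (du_Dr du) //.
rewrite [X in X + _](du_orth du) ?add0r // => mm; apply: ns.
apply: (du_le du (absv_ge0 _ _) (absv_ge0 _ _) (lexx _) _ mm).
by rewrite -absvN opprB ltW.
Qed.

Lemma dbracket_homA (x : V) : homA_set act' (dbracket x).
Proof.
have Vx := set_valP x; split.
  by have [_ /(_ x)] := continuous_curry dbracket_continuous.
split=> [y1 y2 y3 y3E|a y y' y'E]; apply/funext => a'; rewrite /= /Defs.dscale !dbracketE.
  by rewrite y3E (du_Dr du) //; try exact: set_valP; exact: (am_act VM).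
have Va := am_act VM a' Vx.
by rewrite y'E -(md_adj md a Va (set_valP y)) (am_actM VM).
Qed.

Definition dual_map (x : V) : homA constA W act' := SigSub (mem_set (dbracket_homA x)).

Lemma dual_mapE x y : dual_map x y = dbracket x y. Proof. by []. Qed.

Lemma dual_map_continuous : continuous dual_map.
Proof.
move=> x; apply: cvg_set_type; first exact: nbhs_filter.
have [cB _] := continuous_curry dbracket_continuous.
exact: cB.
Qed.

(** [A]-linearity recovers [F] from the scalar functional given by evaluation at 1, which reduces
    duality over [A] to duality over [Fq]. *)
Lemma homA_eval (F : homA constA W act') (y : W) (a : A) :
  exists2 y' : W, \val y' = act' a (\val y) & F y' 1 = F y a.
Proof.
have Wy := am_act WM a (set_valP y).
exists (SigSub (mem_set Wy)) => //.
have [_ [_ FZ]] : homA_set act' (F : W -> dual constA) := set_valP F.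
have -> : F (SigSub (mem_set Wy)) = Defs.dscale a (F y) :> (A -> Fq) by apply: FZ.
by rewrite /Defs.dscale mulr1.
Qed.

Lemma homA_represent (F : homA constA W act') :
  exists x : V, forall y : W, b (\val x) (\val y) = F y 1.
Proof.
have [Fc [FD FZ]] : homA_set act' (F : W -> dual constA) := set_valP F.
(* Extended by 0 outside [W], since [du_represent] takes functions on all of [C]. *)
pose chi (y : Cv) : Fq :=
  if pselect (W y) is left Wy then F (SigSub (mem_set Wy)) 1 else 0.
have chiE (y : W) : chi (\val y) = F y 1.
  rewrite /chi; case: pselect => [Wy|[]]; last exact: set_valP.
  by congr (homA_fun F _ 1); exact: val_inj.
have WE y : W y -> exists y' : W, \val y' = y.
  by move=> Wy; exists (SigSub (mem_set Wy)).
have chiD y1 y2 : W y1 -> W y2 -> chi (y1 + y2) = chi y1 + chi y2.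
  move=> W1 W2; have [y3 E3] := WE _ (lc_D (du_W du) W1 W2).
  have [[y1' E1] [y2' E2]] := (WE _ W1, WE _ W2).
  rewrite -E3 -E1 -E2 !chiE.
  by have := congr1 (fun h => h 1) (FD y1' y2' y3 _); apply; rewrite E1 E2.
have chiZ c y : W y -> chi (iota c * y) = c * chi y.
  move=> Wy; have [y' E] := WE _ Wy.
  have [z Ez] := WE _ (lc_Z (du_W du) c Wy).
  rewrite -Ez -E !chiE.
  have [_ FyZ] : dual_set constA (F y' : A -> Fq) := set_valP (F y').
  rewrite -FyZ.
  have := congr1 (fun h => h 1) (FZ (constA c) y' z _); apply.
  by rewrite Ez E (md_constW md).
have [w0 w0E] := WE _ (lc_0 (du_W du)).
have Fw0 : F w0 1 = 0.
  by rewrite -chiE w0E; have := chiZ 0 0 (lc_0 (du_W du)); rewrite rmorph0 !mul0r.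
(* Because [Fq] is discrete, continuity of [F] at zero makes the functional vanish on a whole ball,
   as [du_represent] requires. *)
have : nbhs w0 [set y : W | F y 1 = 0].
  apply: (Fc w0 [set h : dual constA | h 1 = 0]).
  by apply: open_nbhs_nbhs; split; [exact: dual_eval_open|].
move=> /nbhs_subP[e e0 eF].
have [|x Vx xP] := du_represent complete_v du chiD chiZ e0.
  move=> y Wy ye; have [y' E] := WE _ Wy; rewrite -E chiE; apply: eF.
  by rewrite w0E sub0r absvN E.
by exists (SigSub (mem_set Vx)) => y /=; rewrite xP ?chiE //; exact: set_valP.
Qed.

Lemma dual_map_iso : top_module_iso act dual_map.
Proof.
have act1 (x : V) : act 1 (\val x) = \val x := am_act1 VM (set_valP x).
split.
  move=> y; have Wy := set_valP y; split=> [x1 x2 x3 E|a x x' E]; apply/funext => a'.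
    rewrite /= !dual_mapE !dbracketE E (am_actDr VM); try exact: set_valP.
    by rewrite (du_Dl du) //; apply: (am_act VM); exact: set_valP.
  rewrite /Defs.dscale !dual_mapE !dbracketE E mulrC (am_actM VM) //; exact: set_valP.
have /choice[Psi PsiP] := homA_represent.
have bE (x : V) (y : W) : b (\val x) (\val y) = dual_map x y 1.
  by rewrite dual_mapE dbracketE act1.
have PhiK : cancel dual_map Psi.
  move=> x; apply: val_inj; apply: (du_inj du); try exact: set_valP.
  move=> y Wy; have := PsiP (dual_map x) (SigSub (mem_set Wy)).
  by rewrite -bE.
have PsiK : cancel Psi dual_map.
  move=> F; apply: val_inj; apply/funext => y; apply: val_inj; apply/funext => a.
  have [y' Ey' Fy'] := homA_eval F y a.
  rewrite [LHS](_ : _ = b (act a (\val (Psi F))) (\val y)) //.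
  rewrite (md_adj md) ?(set_valP (Psi F)) //; try exact: set_valP.
  by rewrite -Ey' PsiP.
suff Psic (F0 : homA constA W act') (U : set V) : nbhs (Psi F0) U ->
    nbhs F0 [set F : homA constA W act' | U (Psi F)].
  by exists Psi; split=> //; exact: dual_map_continuous.
move=> /nbhs_subP[e e0 eU].
have [S S0 mS] := du_meetr du e0.
(* The finitely many level sets of [F0] at 1 in the ball of radius [S] are compact. Sending each
   into an open set of characters with the prescribed value at 1 is a compact-open condition, and
   together these conditions force [F] to agree with [F0] at 1 on that ball. *)
pose K c := [set y : W | v (\val y) <= S] `&` [set y : W | F0 y 1 = c].
have [F0c _] : homA_set act' (F0 : W -> dual constA) := set_valP F0.
have Kc c : compact (K c).
  apply: compact_closedI; first exact: (lc_ball_compact complete_v (du_W du) (ltW S0)).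
  move=> y /(_ [set z : W | F0 z 1 = F0 y 1])[|z [/= <- <-] //].
  apply: (F0c y [set h : dual constA | h 1 = F0 y 1]).
  by apply: open_nbhs_nbhs; split; [exact: dual_eval_open|].
have : nbhs F0 [set F : homA constA W act' |
    forall c : Fq, forall y, K c y -> F y 1 = c].
  apply: (@filter_forall _ Fq (fun c (F : homA constA W act') =>
    forall y, K c y -> F y 1 = c) (nbhs F0)) => c.
  pose N : set (homA constA W act') :=
    [set F | (F : W -> dual constA) @` K c `<=` [set chi : dual constA | chi 1 = c]].
  suff : nbhs F0 N by apply: filterS => F FN y Ky; apply: FN; exists y.
  apply: open_nbhs_nbhs; split; last by move=> _ [y [_ yc] <-].
  exists [set h : {compact-open, W -> dual constA} |
    h @` K c `<=` [set chi : dual constA | chi 1 = c]] => //.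
  by apply: compact_open_open; [exact: Kc|exact: dual_eval_open].
apply: filterS => F FK; apply: eU; rewrite ltNge; apply/negP => eF.
have [V0 VF] := (set_valP (Psi F0), set_valP (Psi F)).
(* The difference of the two representatives annihilates the ball of radius [S]. As [e] and [S]
   meet, it must be smaller than [e]. *)
apply: (du_not_meet du (lc_B (du_V du) V0 VF) (ltW S0)).
  move=> y Wy yS; have := PsiP F0 (SigSub (mem_set Wy)).
  have := PsiP F (SigSub (mem_set Wy)) => /= bF bF0.
  rewrite (du_Bl du) // bF bF0 (FK (F0 (SigSub (mem_set Wy)) 1)) ?subrr //.
exact: (du_le du (ltW e0) (ltW S0) eF (lexx _) mS).
Qed.

End TopologicalDuality.

Lemma module_duality_iso (R : realType) (Fq : finFieldType) (C : closedFieldType)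
    (v : nonarch_absval R C) (iota : {rmorphism Fq -> C}) (A : comNzRingType)
    (constA : Fq -> A) (V W : set (valued v)) (b : valued v -> valued v -> Fq)
    (meet : R -> R -> Prop) (act act' : A -> valued v -> valued v) :
  absv_complete v -> module_duality iota constA V W b meet act act' ->
  exists B : V -> W -> dual constA,
    [/\ forall x y, B x y = (fun a => b (act a (\val x)) (\val y)) :> (A -> Fq),
        continuous (fun p : V * W => B p.1 p.2),
        exists Phi : V -> homA constA W act',
          (forall x y, Phi x y = B x y) /\ top_module_iso act Phi &
        exists Phi : W -> homA constA V act,
          (forall y x, Phi y x = B x y) /\ top_module_iso act' Phi].
Proof.
move=> complete_v md; have md' := module_duality_sym md.
exists (dbracket md); split=> //; first exact: dbracket_continuous.
  by exists (dual_map md); split=> //; exact: (dual_map_iso complete_v md).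
exists (dual_map md'); split; last exact: (dual_map_iso complete_v md').
move=> y x; apply: val_inj; apply/funext => a.
exact: esym (md_adj md a (set_valP x) (set_valP y)).
Qed.

(** * Isogenies *)

Section Isogeny.
Variables (R : realType) (Fq : finFieldType) (C : closedFieldType).
Variable v : nonarch_absval R C.
Hypothesis complete_v : absv_complete v.
Variable iota : {rmorphism Fq -> C}.
Local Notation Cv := (valued v).
Local Notation feval := (@feval R Fq C v).
Local Notation fcomp := (@fcomp R Fq C v).
Local Notation fadj := (@fadj R Fq C v).
Local Notation fker := (@fker R Fq C v).
Local Notation pairing := (@pairing R Fq C v iota).
Local Notation fseries := (fseries v).
Local Notation entire := (@entire R Fq C v).
Implicit Types f g h : fseries.

Local Opaque Defs.feval Defs.fker Defs.pairing.

Let adjE f : entire f -> entire (fadj f). Proof. exact: entire_fadj. Qed.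

Lemma fker_lc_subspace f k : entire f -> f k != 0 -> lc_subspace iota (fker f).
Proof.
move=> fE fk; split.
- exact: fker0.
- by move=> x y; exact: fkerD.
- by move=> c x; exact: fkerZ.
- move=> x xV; rewrite fkerE; apply: (@absv_eq0_lt _ _ v) => e e0.
  have [d d0 fd] := feval_small complete_v fE e0.
  have [y fy xy] := xV d d0; rewrite -[x](subrK y) (fevalD complete_v iota) //.
  by move: fy; rewrite fkerE => ->; rewrite addr0; exact: fd.
- move=> r d r0 d0; have [s sP] := ker_precompact complete_v iota fE fk r0 d0.
  by exists s => z; rewrite fkerE; exact: sP.
Qed.

Lemma fadj_coef_neq0 f k : f k != 0 -> fadj f (- k) != 0.
Proof.
by rewrite -!(absv_gt0 v) absv_fadj opprK => fk; exact: rq_gt0.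
Qed.

Lemma fker_duality f k : entire f -> f k != 0 ->
  duality iota (fker f) (fker (fadj f)) (pairing f) (radii_meet Fq f).
Proof.
move=> fE fk; have fk' := fadj_coef_neq0 fk.
split.
- exact: (fker_lc_subspace fE fk).
- exact: (fker_lc_subspace (adjE fE) fk').
- by move=> x1 x2 y; exact: pairingDl.
- by move=> x y1 y2; exact: pairingDr.
- by move=> c x y; exact: pairingZl.
- by move=> c x y; exact: pairingZr.
- by move=> r r' s s'; exact: radii_meet_le.
- by move=> x y; exact: pairing_orth.
- by move=> x s; exact: pairing_nondeg.
- move=> y r fy r0 /(radii_meet_adj r0 (absv_ge0 v y)) m.
  have [x [fx xr b0]] := pairing_nondeg complete_v iota (adjE fE) fy r0 m.
  rewrite (fadjK iota) in fx; exists x; split=> //.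
  by move: b0; rewrite (pairing_anti complete_v iota fE fx fy) oppr_eq0.
- by move=> r r0; exact: radii_meet_exists fk r0.
- move=> s s0; have [r r0 m] := radii_meet_exists Fq fk' s0; exists r => //.
  by move: (radii_meet_adj (ltW s0) (ltW r0) m); rewrite (fadjK iota).
- by move=> r; exact: not_radii_meet_exists.
- move=> s s0; have [r r0 m] := not_radii_meet_exists (adjE fE) s0; exists r => //.
  by move=> /(radii_meet_adj (ltW r0) s0).
Qed.

Lemma fseries_neq0 f : f <> fconst 0 -> exists k, f k != 0.
Proof.
move=> f0; apply: contrapT => nk; apply: f0; apply/funext => n.
rewrite /fconst; case: ifP => _; apply/eqP/negPn/negP => fn; by apply: nk; exists n.
Qed.

Variables (A : comNzRingType) (constA : Fq -> A).

Lemma series_hom_entire (phi : A -> fseries) a :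
  series_hom iota constA phi -> entire (phi a).
Proof. by move=> H; apply/(everywhere_cvgP complete_v iota); exact: sh_cvg H a. Qed.

Section Module.
Variables (phi psi : A -> fseries) (f : fseries).
Hypothesis Hphi : series_hom iota constA phi.
Hypothesis Hpsi : series_hom iota constA psi.
Hypothesis Hf : isogeny Fq phi psi f.

Let phiE a : entire (phi a). Proof. exact: series_hom_entire. Qed.
Let psiE a : entire (psi a). Proof. exact: series_hom_entire. Qed.
Let fE : entire f.
Proof. by apply/(everywhere_cvgP complete_v iota); case: Hf. Qed.
Let psif a : fcomp (psi a) f = fcomp f (phi a). Proof. by case: Hf. Qed.

Lemma isogeny_feval a x : feval f (feval (phi a) x) = feval (psi a) (feval f x).
Proof.
by rewrite -(feval_fcomp complete_v iota) // -psif (feval_fcomp complete_v iota).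
Qed.

Lemma isogeny_feval_adj a y :
  feval (fadj f) (feval (fadj (psi a)) y) = feval (fadj (phi a)) (feval (fadj f) y).
Proof.
apply: etrans (esym (feval_fcomp complete_v iota y (adjE fE) (adjE (psiE a)))) _.
apply: etrans (feval_fcomp complete_v iota y (adjE (phiE a)) (adjE fE)).
congr (feval _ y); apply: etrans (esym (fadj_fcomp complete_v iota (psiE a) fE)) _.
by rewrite psif; exact: fadj_fcomp.
Qed.

Lemma isogeny_fker a x : fker f x -> fker f (feval (phi a) x).
Proof. by rewrite !fkerE isogeny_feval => ->; exact: feval0. Qed.

Lemma isogeny_fker_adj a y : fker (fadj f) y -> fker (fadj f) (feval (fadj (psi a)) y).
Proof. by rewrite !fkerE isogeny_feval_adj => ->; exact: feval0. Qed.

(** Both sides equal the pairing of [x] and [y] for f o phi_a = psi_a o f, computed by the two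
    composition formulas. *)
Lemma isogeny_pairing a x y : fker f x -> fker (fadj f) y ->
  pairing f (feval (phi a) x) y = pairing f x (feval (fadj (psi a)) y).
Proof.
move=> fx fy; have fpx := isogeny_fker a fx.
have fpx' : fker (fcomp f (phi a)) x.
  by rewrite fkerE (feval_fcomp complete_v iota) // -fkerE.
apply: etrans (esym (pairing_fcompl complete_v iota fE (phiE a) fpx' fy)) _.
rewrite -psif.
exact: (pairing_fcompr complete_v iota (psiE a) fE fx (isogeny_fker_adj a fy)).
Qed.

Lemma isogeny_Amodule : Amodule (fker f) (fun a => feval (phi a)).
Proof.
split.
- exact: fker0.
- by move=> x y; exact: fkerD.
- by move=> a x; exact: isogeny_fker.
- by move=> a x y _ _; exact: fevalD.
- by move=> a b x _; rewrite (sh_add Hphi); exact: fevalDl.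
- by move=> a b x _; rewrite (sh_mul Hphi); exact: feval_fcomp.
- by move=> x _; rewrite (sh_one Hphi) (feval_fconst Fq complete_v) mul1r.
Qed.

Lemma isogeny_Amodule_adj : Amodule (fker (fadj f)) (fun a => feval (fadj (psi a))).
Proof.
split.
- exact: fker0.
- by move=> x y; apply: fkerD => //; exact: adjE.
- by move=> a x; exact: isogeny_fker_adj.
- by move=> a x y _ _; apply: fevalD => //; exact: adjE.
- move=> a b x _; rewrite (sh_add Hpsi) (fadjD iota).
  by apply: fevalDl => //; exact: adjE.
(* Adjunction reverses composition; commutativity of [A] restores the order of the action. *)
- move=> a b x _; rewrite mulrC (sh_mul Hpsi) (fadj_fcomp complete_v iota) //.
  by apply: feval_fcomp => //; exact: adjE.
- move=> x _; rewrite (sh_one Hpsi) (fadj_fconst iota).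
  by rewrite (feval_fconst Fq complete_v) mul1r.
Qed.

Lemma isogeny_module_duality :
  module_duality iota constA (fker f) (fker (fadj f)) (pairing f) (radii_meet Fq f)
    (fun a => feval (phi a)) (fun a => feval (fadj (psi a))).
Proof.
have [_ /fseries_neq0[k fk] _] := Hf; split.
- exact: fker_duality fk.
- exact: isogeny_Amodule.
- exact: isogeny_Amodule_adj.
- by move=> c x _; rewrite (sh_const Hphi) (feval_fconst Fq complete_v).
- move=> c y _; rewrite (sh_const Hpsi) (fadj_fconst iota).
  by rewrite (feval_fconst Fq complete_v).
- exact: isogeny_pairing.
- move=> a e e0; have [d d0 dP] := feval_small complete_v (phiE a) e0.
  by exists d => // x _; exact: dP.
- move=> a e e0; have [d d0 dP] := feval_small complete_v (adjE (psiE a)) e0.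
  by exists d => // y _; exact: dP.
Qed.

End Module.

Section Composition.
Variables (phi psi Psi : A -> fseries) (f h : fseries).
Hypothesis Hphi : series_hom iota constA phi.
Hypothesis Hpsi : series_hom iota constA psi.
Hypothesis HPsi : series_hom iota constA Psi.
Hypothesis Hf : isogeny Fq phi psi f.
Hypothesis Hh : isogeny Fq Psi phi h.

Let fE : entire f.
Proof. by apply/(everywhere_cvgP complete_v iota); case: Hf. Qed.
Let hE : entire h.
Proof. by apply/(everywhere_cvgP complete_v iota); case: Hh. Qed.

Lemma fker_fcompE x : fker (fcomp f h) x = fker f (feval h x).
Proof. by rewrite !fkerE (feval_fcomp complete_v iota). Qed.

Lemma fker_fadj_fcompE y :
  fker (fadj (fcomp f h)) y = fker (fadj h) (feval (fadj f) y).
Proof.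
rewrite !fkerE (fadj_fcomp complete_v iota) //.
by rewrite (feval_fcomp complete_v iota y (adjE hE) (adjE fE)).
Qed.

Lemma bracket_fcompl x y : fker (fcomp f h) x -> fker (fadj f) y ->
  bracket iota (fcomp f h) Psi x y = bracket iota f phi (feval h x) y.
Proof.
rewrite fker_fcompE => fhx fy; apply/funext => a.
have hP := isogeny_feval HPsi Hphi Hh a x.
have fhPx : fker (fcomp f h) (feval (Psi a) x).
  by rewrite fker_fcompE hP; exact: (isogeny_fker Hphi Hpsi Hf).
apply: etrans (pairing_fcompl complete_v iota fE hE fhPx fy) _.
exact: (congr1 (fun z => pairing f z y) hP).
Qed.

Lemma bracket_fcompr x y : fker h x -> fker (fadj (fcomp f h)) y ->
  bracket iota (fcomp f h) Psi x y = bracket iota h Psi x (feval (fadj f) y).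
Proof.
rewrite fker_fadj_fcompE => hx hy; apply/funext => a.
exact: (pairing_fcompr complete_v iota fE hE (isogeny_fker HPsi Hphi Hh a hx) hy).
Qed.

End Composition.
End Isogeny.

Theorem proposition9p1 (R : realType) (Fq : finFieldType) (X : curve Fq)
    (oo : closed_point X) (C : closedFieldType) (v : nonarch_absval R C)
    (Cv : absv_complete v) (iota : {rmorphism Fq -> C})
    (phi psi : regring oo -> fseries v) (f : fseries v)
    (Hphi : series_hom iota (@regconst _ X oo) phi)
    (Hpsi : series_hom iota (@regconst _ X oo) psi)
    (Hf : isogeny Fq phi psi f) :
  let actphi (a : regring oo) (z : valued v) := feval Fq (phi a) z in
  let actpsi (a : regring oo) (z : valued v) := feval Fq (fadj Fq (psi a)) z in
  let kf := fker Fq f in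
  let kf' := fker Fq (fadj Fq f) in
  [/\ forall a alpha beta, kf alpha -> kf' beta ->
        pairing iota f (feval Fq (phi a) alpha) beta =
        pairing iota f alpha (feval Fq (fadj Fq (psi a)) beta),
      Amodule kf actphi /\ Amodule kf' actpsi,
      Apairing kf kf' actphi actpsi (bracket iota f phi),
      exists B : kf -> kf' -> dual (@regconst _ X oo),
        [/\ forall alpha beta,
              B alpha beta = bracket iota f phi (\val alpha) (\val beta)
              :> (regring oo -> Fq),
            continuous (fun p : kf * kf' => B p.1 p.2),
            exists Phi : kf -> homA (@regconst _ X oo) kf' actpsi,
              (forall alpha beta, Phi alpha beta = B alpha beta) /\
              top_module_iso actphi Phi &
            exists Phi : kf' -> homA (@regconst _ X oo) kf actphi,
              (forall beta alpha, Phi beta alpha = B alpha beta) /\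
              top_module_iso actpsi Phi]
    & forall (Psi : regring oo -> fseries v) (h : fseries v),
        series_hom iota (@regconst _ X oo) Psi -> isogeny Fq Psi phi h ->
        let fh := fcomp Fq f h in
        (kf' `<=` fker Fq (fadj Fq fh) /\
         forall alpha beta, fker Fq fh alpha -> kf' beta ->
           bracket iota fh Psi alpha beta =
           bracket iota f phi (feval Fq h alpha) beta) /\
        (fker Fq h `<=` fker Fq fh /\
         forall alpha beta, fker Fq h alpha -> fker Fq (fadj Fq fh) beta ->
           bracket iota fh Psi alpha beta =
           bracket iota h Psi alpha (feval Fq (fadj Fq f) beta))].
Proof.
move=> actphi actpsi kf kf'.
have md := isogeny_module_duality Cv Hphi Hpsi Hf.
split.
- move=> a alpha beta; exact: (isogeny_pairing Cv Hphi Hpsi Hf).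
- by split; [exact: (md_V md)|exact: (md_W md)].
- exact: (module_duality_Apairing md).
- exact: (module_duality_iso Cv md).
- move=> Psi h HPsi Hh fh.
  split; split.
  + move=> beta; rewrite /kf' /fh (fker_fadj_fcompE Cv iota Hf Hh) !fkerE => ->.
    exact: feval0.
  + move=> alpha beta; exact: (bracket_fcompl Cv Hphi Hpsi HPsi Hf Hh).
  + move=> alpha; rewrite /fh (fker_fcompE Cv iota Hf Hh) !fkerE => ->.
    exact: feval0.
  + move=> alpha beta; exact: (bracket_fcompr Cv Hphi HPsi Hf Hh).
Qed.
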